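(* Let $n\ge2$ and let $\Omega$ be an open proper subset of $\mathbb{R}^n$ having the outer regularity property with constant $b>0$. Let $\delta\in(0,n]$, $\kappa\in[0,1)$ and $p\in(\delta/n,\delta/\kappa)$ (with $\delta/0:=\infty$). Then there exists a constant $c\in(0,\infty)$ depending only on $n,\delta,\kappa,p,b$ such that \[ \int_{\Omega}\frac{|u(x)|^p}{\operatorname{dist}(x,\partial\Omega)^{p(1-\kappa)}}\,d\mathcal{H}_{\infty}^{\delta-\kappa p}\le c\int_{\Omega}|\nabla u(x)|^p\,d\mathcal{H}_{\infty}^{\delta} \] for all $u\in C^1_0(\Omega)$.
   Context: An open proper subset $\Omega\subset\mathbb{R}^n$ has the outer regularity property with constant $b>0$ if $|B(y,r)\setminus\Omega|\ge b|B(y,r)|$ for every $y\in\partial\Omega$ and every $r>0$ ($|\cdot|$ is Lebesgue measure). For $E\subset\mathbb{R}^n$ and $\beta\in(0,n]$, $\mathcal{H}^{\beta}_\infty(E)=\inf\{\sum_i r_i^{\beta}: E\subset\bigcup_i B(x_i,r_i)\}$ over countable or finite coverings by open balls. For $f:\Omega\to[0,\infty]$, $\int_\Omega f\,d\mathcal{H}^{\beta}_\infty:=\int_0^\infty \mathcal{H}^{\beta}_\infty(\{x\in\Omega: f(x)>t\})\,dt$. $C^1_0(\Omega)$ denotes continuously differentiable functions with compact support in $\Omega$. *)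

(* Defs.v *)
From HB Require Import structures.
From mathcomp Require Import all_boot all_order all_algebra.
From mathcomp Require Import all_classical all_reals all_analysis.
Set Implicit Arguments. Unset Strict Implicit. Unset Printing Implicit Defensive.
Import Order.TTheory GRing.Theory Num.Theory.
Import numFieldNormedType.Exports.
Local Open Scope classical_set_scope.
Local Open Scope ring_scope.

Section Defs.
Variables (R : realType) (n : nat).
Local Notation V := 'rV[R]_n.

Definition enorm (x : V) : R := Num.sqrt (\sum_(i < n) x ord0 i ^+ 2).

Definition eball (y : V) (r : R) : set V := [set x | enorm (x - y) < r].

(* Lebesgue (outer) measure on R^n: infimum of total volumes of countable
   covers by open boxes ]a_k, b_k[ (equals Lebesgue measure on measurable sets) *)
Definition lebesgue_outer (A : set V) : \bar R :=
  ereal_inf [set s : \bar R | exists (a b : nat -> V),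
    (forall k (i : 'I_n), a k ord0 i <= b k ord0 i) /\
    A `<=` \bigcup_k [set x : V | forall i : 'I_n, a k ord0 i < x ord0 i < b k ord0 i] /\
    s = (\sum_(0 <= k <oo) (\prod_(i < n) (b k ord0 i - a k ord0 i))%:E)%E].

Definition bdry (O : set V) : set V := closure O `\` interior O.

Definition outer_regular (O : set V) (b : R) : Prop :=
  forall y, bdry O y -> forall r : R, 0 < r ->
    (b%:E * lebesgue_outer (eball y r) <= lebesgue_outer (eball y r `\` O))%E.

(* Hausdorff content H^beta_infty: countable (finite covers are encoded by
   radius-0, i.e. empty, balls) coverings by open balls *)
Definition hcontent (beta : R) (E : set V) : \bar R :=
  ereal_inf [set s : \bar R | exists (c : nat -> V) (r : nat -> R),
    (forall k, 0 <= r k) /\ E `<=` \bigcup_k eball (c k) (r k) /\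
    s = (\sum_(0 <= k <oo) (r k `^ beta)%:E)%E].

Definition choquet (beta : R) (O : set V) (f : V -> R) : \bar R :=
  (\int[@lebesgue_measure R]_(t in `[0%R, +oo[%classic)
     hcontent beta [set x | O x /\ (t < f x)%R])%E.

Definition dist_bdry (O : set V) (x : V) : R :=
  inf [set enorm (x - y) | y in bdry O].

Definition evec (i : 'I_n) : V := delta_mx ord0 i.
Definition grad_norm (u : V -> R) (x : V) : R :=
  Num.sqrt (\sum_(i < n) ('D_(evec i) u x) ^+ 2).

Definition C1_0 (O : set V) (u : V -> R) : Prop :=
  (forall x, differentiable u x) /\
  (forall i, continuous (fun x => 'D_(evec i) u x)) /\
  compact (closure [set x | u x != 0]) /\
  closure [set x | u x != 0] `<=` O.
End Defs.

(* Main.v *)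
(** The proof compares [u] with its gradient along segments that leave [O], and only ever
    uses a covering of the level sets [{|grad u| > 2^k}] by balls [B(c_kj, rho_kj)] with
    [sum_j rho_kj^delta] close to their Hausdorff content.

    - Pointwise estimate. Fix [x] at distance [d] from the boundary and [y] on the boundary
      nearly closest to [x]. By outer regularity the set [A = B(y, 2d) \ O], where [u] vanishes,
      has measure at least a multiple of [d^n]. Averaging [|u x - u z|] over [z] in [A], where
      [|u x - u z|] is estimated by the time which the segment from [x] to [z] spends in the
      balls, gives [|u x| <= C T d^(1 - kappa)] as soon as, for all [k] and [r], either
      [2^k r^kappa <= T] or the balls of level [k] have density at most
      [(T / (2^k r^kappa))^s] in [B(x, r)]. Here [1 < s < n p / delta].

    - Covering. The points around which the balls of level [k] have density more than [nu] at
      some scale are covered by maximal dyadic cubes [Q], which are disjoint and satisfy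
      [nu^(delta / n) l(Q)^delta <= C sum_(c_kj in Q) rho_kj^delta] because [delta <= n]. Taking
      [nu = 2^(-(l + 1) s)] and summing over [k] and [l] bounds the content of every level set
      of [|u|^p / d^(p (1 - kappa))]; the sum over [l] converges because [s delta / n < p]. *)

Require Import Defs.
From HB Require Import structures.
From mathcomp Require Import all_boot all_order all_algebra.
From mathcomp Require Import all_classical all_reals all_analysis.
From mathcomp Require Import measurable_realfun ring lra.
Import Order.TTheory GRing.Theory Num.Theory.
Import numFieldNormedType.Exports.
Local Open Scope classical_set_scope.
Local Open Scope ring_scope.

(** * Outer measures defined by countable coverings *)

Lemma nat_pair_enum : exists f : nat -> nat * nat,
  (forall ij, exists k, f k = ij) /\
  forall (R : realType) (a : nat * nat -> \bar R), (forall ij, (0 <= a ij)%E) ->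
    (\sum_(0 <= k <oo) a (f k) = \sum_(0 <= i <oo) \sum_(0 <= j <oo) a (i, j))%E.
Proof.
have /card_esym/ppcard_eqP[f] := card_nat2.
exists f; split=> [ij|R a a0].
  by exists (f^-1%FUN ij); rewrite invK ?inE.
rewrite (@nneseries_esumT _ (fun k => a (f k)))//.
rewrite -(@reindex_esum R _ _ [set: nat] [set: nat * nat] f a)//.
under [in RHS]eq_eseriesr do rewrite nneseries_esumT//.
rewrite nneseries_esumT; last by move=> i; apply: esum_ge0.
rewrite esum_esum//; congr esum.
  by apply/seteqP; split=> -[].
by apply/funext => -[].
Qed.

(** Common form of the outer Lebesgue measure, with [I] the boxes, and of the Hausdorff content,
    with [I] the balls; [P] selects the admissible indices. Near-optimal coverings are thus obtained
    once for both. *)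
Definition cover_inf {R : realType} {T I : Type} (P : I -> Prop) (S : I -> set T)
    (w : I -> \bar R) (E : set T) : \bar R :=
  ereal_inf [set s | exists k : nat -> I,
    [/\ forall j, P (k j), E `<=` \bigcup_j S (k j) &
        s = (\sum_(0 <= j <oo) w (k j))%E]].

Section cover_inf.
Local Open Scope ereal_scope.
Context {R : realType} {T I : Type} (P : I -> Prop) (S : I -> set T) (w : I -> \bar R).
Hypothesis w0 : forall i, P i -> 0 <= w i.
Local Notation mu := (cover_inf P S w).

Lemma cover_inf_ge0 E : 0 <= mu E.
Proof.
apply: le_ereal_inf_tmp => _ [k [Pk _ ->]].
by apply: nneseries_ge0 => j _ _; exact: w0.
Qed.

Lemma le_cover_inf E F : E `<=` F -> mu E <= mu F.
Proof.
move=> EF; apply: le_ereal_inf_tmp => s [k [Pk Fk ->]].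
by apply: ereal_inf_lbound; exists k; split=> //; exact: subset_trans Fk.
Qed.

Lemma cover_inf_le (k : nat -> I) E : (forall j, P (k j)) ->
  E `<=` \bigcup_j S (k j) -> mu E <= \sum_(0 <= j <oo) w (k j).
Proof. by move=> Pk Ek; apply: ereal_inf_lbound; exists k. Qed.

Lemma cover_inf_near E (e : R) : (0 < e)%R -> mu E < +oo ->
  exists k : nat -> I, [/\ forall j, P (k j), E `<=` \bigcup_j S (k j) &
    \sum_(0 <= j <oo) w (k j) <= mu E + e%:E].
Proof.
move=> e0 Eoo.
have Efin : mu E \is a fin_num by rewrite ge0_fin_numE// cover_inf_ge0.
have [_ [k [Pk Ek ->]] /ltW le] := lb_ereal_inf_adherent e0 Efin.
by exists k.
Qed.

(** Coverings of the [A n], each optimal up to [e / 2 ^ n.+1], are merged into one along an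
    enumeration of pairs. *)
Lemma cover_inf_sigma_subadditive : sigma_subadditive mu.
Proof.
move=> A; have [[i ioo]|] := pselect (exists i, mu (A i) = +oo).
  rewrite (eseries_pinfty _ _ ioo) ?leey// => n _.
  by rewrite -ltNye (lt_le_trans _ (cover_inf_ge0 _)).
rewrite -forallNE => Aoo.
apply/lee_addgt0Pr => e e0.
rewrite (le_trans _ (epsilon_trick _ _ (ltW e0)))//; last first.
  by move=> n; exact: cover_inf_ge0.
have /choice[G PG] : forall n, exists k : nat -> I,
    [/\ forall j, P (k j), A n `<=` \bigcup_j S (k j) &
    \sum_(0 <= j <oo) w (k j) <= mu (A n) + (e / (2 ^ n.+1)%:R)%:E].
  move=> n; apply: cover_inf_near; first by rewrite divr_gt0// ltr0n expn_gt0.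
  by rewrite ltey; exact/eqP/Aoo.
have PGij i j : P (G i j) by have [+ _ _] := PG i; apply.
have [f [fS fE]] := nat_pair_enum.
apply: (@le_trans _ _ (\sum_(0 <= k <oo) w (uncurry G (f k)))).
  apply: cover_inf_le => [j|x [n _ Anx]]; first by case: (f j).
  have [_ /(_ _ Anx)[j _ Sj] _] := PG n.
  by have [k fk] := fS (n, j); exists k => //; rewrite fk.
rewrite (fE _ (fun ij => w (uncurry G ij))); last first.
  by move=> -[i j] /=; apply: w0; exact: PGij.
apply: lee_nneseries => [i _ _|i _]; last by have [] := PG i.
by apply: nneseries_ge0 => j _ _; apply: w0; exact: PGij.
Qed.

End cover_inf.

(** * Lebesgue measure *)

Definition box {R : realType} {n : nat} (ab : 'rV[R]_n * 'rV[R]_n) : set 'rV[R]_n :=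
  [set x | forall i, ab.1 ord0 i < x ord0 i < ab.2 ord0 i].

Definition box_le {R : realType} {n : nat} (ab : 'rV[R]_n * 'rV[R]_n) : Prop :=
  forall i, ab.1 ord0 i <= ab.2 ord0 i.

Definition box_vol {R : realType} {n : nat} (ab : 'rV[R]_n * 'rV[R]_n) : R :=
  \prod_(i < n) (ab.2 ord0 i - ab.1 ord0 i).

Lemma box_vol_ge0 {R : realType} {n : nat} (ab : 'rV[R]_n * 'rV[R]_n) :
  box_le ab -> 0 <= box_vol ab.
Proof. by move=> le_ab; apply: prodr_ge0 => i _; rewrite subr_ge0. Qed.

Lemma lebesgue_outerE {R : realType} {n : nat} :
  @lebesgue_outer R n = cover_inf box_le box (fun ab => (box_vol ab)%:E).
Proof.
apply/funext => A; congr ereal_inf; apply/seteqP; split=> s /=.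
  move=> [a [b [le_ab [Acov ->]]]]; by exists (fun k => (a k, b k)).
move=> [k [Pk Ak ->]]; by exists (fun j => (k j).1), (fun j => (k j).2).
Qed.

(** Both terms of the difference are clampings to the interval from [x] to [y], one of [c] and one
    of [c - s], and clamping does not increase distances. *)
Lemma clamp_split {R : realDomainType} (x y c s : R) : x <= y -> 0 <= s ->
  Num.max x (Num.min y c) - Num.min y (Num.max x (c - s)) <= s.
Proof.
move=> xy s0; rewrite /Order.max /Order.min.
by do ![case: ifPn; rewrite -?leNgt] => *; lra.
Qed.

(** * Caratheodory measurability of boxes *)

Section lebesgue_outer_measure.
Context {R : realType} {n : nat}.
Local Notation V := 'rV[R]_n.+1.
Local Notation mu := (@lebesgue_outer R n.+1).
Local Open Scope ereal_scope.

Let vol0 (ab : V * V) : box_le ab -> 0 <= (box_vol ab)%:E.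
Proof. by move=> ab0; rewrite lee_fin box_vol_ge0. Qed.

(** The degenerate box at the origin has volume 0 only because the dimension is positive; in
    dimension 0 the empty product would give every box volume 1. *)
Lemma lebesgue_outer0 : mu set0 = 0.
Proof.
rewrite lebesgue_outerE; apply/eqP; rewrite eq_le cover_inf_ge0// andbT.
apply: (@le_trans _ _ (\sum_(0 <= j <oo) (box_vol ((0, 0)%R : V * V))%:E)).
  by apply: cover_inf_le => // j i /=.
rewrite eseries0// => j _ _; rewrite /box_vol (bigD1 ord0)//=.
by rewrite subrr mul0r.
Qed.

Lemma lebesgue_outer_ge0 (A : set V) : 0 <= mu A.
Proof. by rewrite lebesgue_outerE; exact: cover_inf_ge0. Qed.

Lemma le_lebesgue_outer : {homo mu : A B / A `<=` B >-> A <= B}.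
Proof. by rewrite lebesgue_outerE; exact: le_cover_inf. Qed.

Lemma lebesgue_outer_sigma_subadditive : sigma_subadditive mu.
Proof. by rewrite lebesgue_outerE; exact: cover_inf_sigma_subadditive. Qed.

HB.instance Definition _ := isOuterMeasure.Build R V mu lebesgue_outer0
  lebesgue_outer_ge0 le_lebesgue_outer lebesgue_outer_sigma_subadditive.

Lemma lebesgue_outer_box (ab : V * V) : box_le ab -> mu (box ab) <= (box_vol ab)%:E.
Proof.
move=> le_ab; pose k j := if j is 0%N then ab else (0, 0)%R : V * V.
have vol_k : \sum_(0 <= j <oo) (box_vol (k j))%:E = (box_vol ab)%:E.
  rewrite nneseries_recl//=; last by case=> [|j] _ /=; apply: vol0 => // i /=.
  rewrite eseries_cond/= eseries0 ?adde0// => -[|j]//= _ _.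
  by rewrite /box_vol (bigD1 ord0)//= subrr mul0r.
rewrite lebesgue_outerE -vol_k; apply: (@cover_inf_le _ _ _ _ box (fun ab => (box_vol ab)%:E) k).
  by case=> // j i /=.
by move=> x xab; exists 0%N.
Qed.

Definition upd (a : V) (i : 'I_n.+1) (t : R) : V :=
  (\row_j (if j == i then t else a ord0 j))%R.

Lemma box_vol_upd2 (a b : V) i s : box_vol (a, upd b i s) =
  ((s - a ord0 i) * \prod_(j | j != i) (b ord0 j - a ord0 j))%R.
Proof.
rewrite /box_vol (bigD1 i)//= mxE eqxx; congr (_ * _)%R.
by apply: eq_bigr => j /negbTE ji; rewrite mxE ji.
Qed.

Lemma box_vol_upd1 (a b : V) i s : box_vol (upd a i s, b) =
  ((b ord0 i - s) * \prod_(j | j != i) (b ord0 j - a ord0 j))%R.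
Proof.
rewrite /box_vol (bigD1 i)//= mxE eqxx; congr (_ * _)%R.
by apply: eq_bigr => j /negbTE ji; rewrite mxE ji.
Qed.

(** Boxes are open whereas the half [c <= x i] is closed, so the second box starts slightly before
    [c], at [c - s]. The overlap has volume at most [s * Q], hence at most [e]; the summand 1 in the
    denominator of [s] guards against [Q = 0]. *)
Lemma box_split (i : 'I_n.+1) (c e : R) (ab : V * V) : box_le ab -> (0 < e)%R ->
  exists lr : (V * V) * (V * V), [/\ box_le lr.1, box_le lr.2,
    box ab `&` [set x | x ord0 i < c]%R `<=` box lr.1,
    box ab `&` ~` [set x | x ord0 i < c]%R `<=` box lr.2 &
    (box_vol lr.1 + box_vol lr.2 <= box_vol ab + e)%R].
Proof.
case: ab => a b le_ab e0.
pose Q := (\prod_(j | j != i) (b ord0 j - a ord0 j))%R.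
have Q0 : (0 <= Q)%R by apply: prodr_ge0 => j _; rewrite subr_ge0; exact: le_ab.
pose s := (e / (1 + Q))%R.
have s0 : (0 < s)%R by rewrite divr_gt0// ltr_pwDl.
have sQ : (s * Q <= e)%R.
  by rewrite /s mulrAC ler_pdivrMr ?ltr_pwDl// ler_pM2l// lerDr.
have abi : (a ord0 i <= b ord0 i)%R by exact: le_ab.
pose t := Num.max (a ord0 i) (Num.min (b ord0 i) c).
pose t' := Num.min (b ord0 i) (Num.max (a ord0 i) (c - s)%R).
have tt' : [/\ (a ord0 i <= t)%R, (t' <= b ord0 i)%R & (t - t' <= s)%R].
  rewrite /t /t'; split; [by rewrite le_max lexx|by rewrite ge_min lexx|].
  by apply: clamp_split => //; exact: ltW.
case: tt' => at_ t'b tt'.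
exists ((a, upd b i t), (upd a i t', b)); split=> /=.
- by move=> j /=; rewrite mxE; case: eqP => [->//|_]; exact: le_ab.
- by move=> j /=; rewrite mxE; case: eqP => [->//|_]; exact: le_ab.
- move=> x [xab /= xc] j /=; have /= /andP[h1 h2] := xab j.
  rewrite mxE h1; case: eqP => [ji|_//]; subst j.
  by rewrite /t lt_max lt_min h2 xc orbT.
- move=> x [xab /= /negP]; rewrite -leNgt => cx j /=; have /= /andP[h1 h2] := xab j.
  rewrite mxE h2 andbT; case: eqP => [ji|_//]; subst j.
  by rewrite /t' gt_min gt_max h1/=; apply/orP; right; lra.
- rewrite box_vol_upd2 box_vol_upd1 /box_vol [in leRHS](bigD1 i)//= -/Q.
  rewrite -mulrDl; apply: (@le_trans _ _ ((b ord0 i - a ord0 i + s) * Q)%R).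
    by apply: ler_wpM2r => //; lra.
  by rewrite mulrDl lerD2l.
Qed.

(** Each box of a covering optimal up to [e / 2] is cut in two by [box_split]; the excess volumes
    [e / 2 / 2 ^ j.+1] add up to the other [e / 2]. *)
Lemma half_space_caratheodory (i : 'I_n.+1) (c : R) :
  mu.-caratheodory [set x : V | x ord0 i < c]%R.
Proof.
set H := mkset _.
apply: le_caratheodory_measurable => X.
suff: mu (X `&` H) + mu (X `&` ~` H) <= mu X by [].
have [->|Xoo] := eqVneq (mu X) +oo; first by rewrite leey.
apply/lee_addgt0Pr => e e0.
have e20 : (0 < e / 2)%R by rewrite divr_gt0.
have [|k [Pk Xk sk]] := @cover_inf_near R V _ box_le box _ vol0 X _ e20.
  by rewrite -lebesgue_outerE ltey.
have ej j : (0 < e / 2 / (2 ^ j.+1)%:R :> R)%R by rewrite divr_gt0// ltr0n expn_gt0.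
have /choice[f Pf] := fun j => box_split i c _ (k j) (Pk j) (ej j).
have le1 : mu (X `&` H) <= \sum_(0 <= j <oo) (box_vol (f j).1)%:E.
  rewrite lebesgue_outerE; apply: (@cover_inf_le _ _ _ _ box (fun ab => (box_vol ab)%:E) (fun j => (f j).1)).
    by move=> j; have [] := Pf j.
  move=> x [Xx Hx]; have [j _ kj] := Xk _ Xx; exists j => //.
  by have [_ _ h _ _] := Pf j; apply: h.
have le2 : mu (X `&` ~` H) <= \sum_(0 <= j <oo) (box_vol (f j).2)%:E.
  rewrite lebesgue_outerE; apply: (@cover_inf_le _ _ _ _ box (fun ab => (box_vol ab)%:E) (fun j => (f j).2)).
    by move=> j; have [] := Pf j.
  move=> x [Xx Hx]; have [j _ kj] := Xk _ Xx; exists j => //.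
  by have [_ _ _ h _] := Pf j; apply: h.
apply: (le_trans (leeD le1 le2)); rewrite -nneseriesD; last 2 first.
- by move=> j _ _; apply: vol0; have [] := Pf j.
- by move=> j _ _; apply: vol0; have [] := Pf j.
apply: (@le_trans _ _ (\sum_(0 <= j <oo) ((box_vol (k j))%:E + (e / 2 / (2 ^ j.+1)%:R)%:E))).
  apply: lee_nneseries => [j _ _|j _].
    by apply: adde_ge0; apply: vol0; have [] := Pf j.
  by rewrite -!EFinD lee_fin; have [] := Pf j.
apply: (le_trans (epsilon_trick _ _ (ltW e20))); first by move=> j; exact: vol0.
move: sk; rewrite -lebesgue_outerE => sk.
by rewrite [in leRHS](splitr e) EFinD addeA leeD2r.
Qed.

Local Notation W := (caratheodory_type mu).

Let lebesgue_sigma_additive : semi_sigma_additive (mu : set W -> \bar R).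
Proof. exact: (@caratheodory_measure_sigma_additive R V mu). Qed.

HB.instance Definition _ := isMeasure.Build _ W R (mu : set W -> \bar R)
  lebesgue_outer0 lebesgue_outer_ge0 lebesgue_sigma_additive.

Lemma coord_measurable (i : 'I_n.+1) :
  measurable_fun [set: W] (fun x : W => (x : V) ord0 i).
Proof.
apply: (measurability _ (RGenInftyO.measurableE R)).
move=> _ [_ [c ->] <-]; rewrite setTI.
rewrite (_ : _ @^-1` _ = [set x : V | x ord0 i < c]%R); first exact: half_space_caratheodory.
by apply/seteqP; split => x /=; rewrite in_itv.
Qed.

Lemma box_measurable (ab : V * V) : measurable (box ab : set W).
Proof.
rewrite (_ : box ab = \bigcap_(i in [set: 'I_n.+1])
    ((fun x : W => (x : V) ord0 i) @^-1` `]ab.1 ord0 i, ab.2 ord0 i[%classic)).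
  apply: fin_bigcap_measurable => // i _; rewrite -[X in measurable X]setTI.
  exact: coord_measurable.
apply/seteqP; split=> x /= xab i; first by move=> _; rewrite ?in_itv/=; exact: xab.
by have := xab i I; rewrite /= ?in_itv.
Qed.

End lebesgue_outer_measure.

(* [dominated h v] is an upper bound on the upper Lebesgue integral of an arbitrary
   function: [h] need not be measurable, as it lives below a measurable [g]. *)
Definition dominated {R : realType} {n : nat} (h : 'rV[R]_n.+1 -> \bar R) (v : \bar R) :=
  exists g : caratheodory_type (@lebesgue_outer R n.+1) -> \bar R,
  [/\ measurable_fun setT g, forall x, (0 <= g x)%E, forall x, (h x <= g x)%E &
      (\int[(@lebesgue_outer R n.+1 : set (caratheodory_type (@lebesgue_outer R n.+1)) -> \bar R)]_x g x <= v)%E].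

Section dominated.
Context {R : realType} {n : nat}.
Local Notation V := 'rV[R]_n.+1.
Local Notation mu := (@lebesgue_outer R n.+1).
Local Notation W := (caratheodory_type mu).
Local Notation muW := (mu : set W -> \bar R).
Local Open Scope ereal_scope.

Lemma dominated_le (h h' : V -> \bar R) v v' : (forall x, h' x <= h x) -> v <= v' ->
  dominated h v -> dominated h' v'.
Proof.
move=> hh' vv' [g [mg g0 hg gv]]; exists g; split=> // [x|].
  exact: le_trans (hg x).
exact: le_trans vv'.
Qed.

Lemma dominated0 : dominated (fun _ : V => 0 : \bar R) 0.
Proof. by exists (cst 0); split=> //; rewrite integral0_eq. Qed.

Lemma dominatedD (h h' : V -> \bar R) v v' : dominated h v -> dominated h' v' ->
  dominated (fun x => h x + h' x) (v + v').
Proof.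
move=> [g [mg g0 hg gv]] [g' [mg' g'0 hg' gv']].
exists (fun x => g x + g' x); split=> [|x|x|].
- exact: emeasurable_funD.
- exact: adde_ge0.
- exact: leeD.
- by rewrite ge0_integralD//; exact: leeD.
Qed.

Lemma dominated_sum (h : nat -> V -> \bar R) (v : nat -> \bar R) N :
  (forall i, dominated (h i) (v i)) ->
  dominated (fun x => \sum_(i < N) h i x) (\sum_(i < N) v i).
Proof.
move=> hv; elim: N => [|N IH].
  rewrite big_ord0; apply: dominated_le dominated0 => // x.
  by rewrite big_ord0.
rewrite big_ord_recr/=; apply: dominated_le (dominatedD _ _ _ _ IH (hv N)) => // x.
by rewrite big_ord_recr.
Qed.

Lemma dominated_series (h : nat -> V -> \bar R) (v : nat -> \bar R) :
  (forall i x, 0 <= h i x) -> (forall i, dominated (h i) (v i)) ->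
  dominated (fun x => \sum_(0 <= i <oo) h i x) (\sum_(0 <= i <oo) v i).
Proof.
move=> h0 /choice[g Pg].
exists (fun x => \sum_(0 <= i <oo) g i x); split=> [|x|x|].
- by apply: ge0_emeasurable_sum => // i; have [] := Pg i.
- by apply: nneseries_ge0 => i _ _; have [] := Pg i.
- by apply: lee_nneseries => [i _ _|i _]; [exact: h0|have [] := Pg i].
- rewrite integral_nneseries//; last 2 first.
  + by move=> i; have [] := Pg i.
  + by move=> i x _; have [] := Pg i.
  apply: lee_nneseries => [i _ _|i _]; last by have [] := Pg i.
  by apply: integral_ge0 => x _; have [] := Pg i.
Qed.

Lemma dominatedZ (h : V -> \bar R) v (c : R) : (0 <= c)%R -> dominated h v ->
  dominated (fun x => c%:E * h x) (c%:E * v).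
Proof.
move=> c0 [g [mg g0 hg gv]].
exists (fun x => c%:E * g x); split=> [|x|x|].
- exact: measurable_funeM.
- by rewrite mule_ge0.
- by rewrite lee_wpmul2l.
- by rewrite ge0_integralZl// lee_wpmul2l.
Qed.

Lemma dominated_box (ab : V * V) : box_le ab ->
  dominated (fun x => (\1_(box ab) x)%:E) (box_vol ab)%:E.
Proof.
move=> le_ab; exists (fun x => (\1_(box ab) x)%:E); split=> //.
- apply/measurable_EFinP; apply: measurable_indic; exact: box_measurable.
- rewrite integral_indic//; last exact: box_measurable.
  by rewrite setIT; exact: lebesgue_outer_box.
Qed.

(** Markov's inequality for an arbitrary set [A]: it lies in a superlevel set of the measurable
    majorant, and the outer measure is monotone. *)
Lemma dominated_markov (h : V -> \bar R) v (A : set V) (l : R) : (0 <= l)%R ->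
  dominated h v -> (forall x, A x -> l%:E <= h x) -> l%:E * mu A <= v.
Proof.
move=> l0 [g [mg g0 hg gv]] Ah; apply: le_trans gv.
pose S := [set x : W | l%:E <= g x].
have mS : measurable S.
  by rewrite -[S]setTI; exact: emeasurable_fun_c_infty.
apply: (@le_trans _ _ (l%:E * mu S)).
  rewrite lee_wpmul2l//; apply: le_outer_measure => x Ax.
  by apply: le_trans (hg x); exact: Ah.
rewrite -integral_cst//; apply: (@le_trans _ _ (\int[muW]_(x in S) g x)).
  apply: ge0_le_integral => //; exact: measurable_funS mg.
exact: ge0_subset_integral.
Qed.

Definition cube (c : V) (r : R) : V * V := (\row_i (c ord0 i - r), \row_i (c ord0 i + r))%R.

Lemma cubeE (c : V) r : (0 < r)%R -> box (cube c r) = [set x | `|x - c| < r]%R.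
Proof.
move=> r0; apply/seteqP; split=> x /=.
  move=> xc; rewrite [X in (X < _)%R]/Num.norm/= mx_normrE.
  apply: bigmax_lt => // -[i j] _ /=; rewrite !ord1.
  have := xc j; rewrite !mxE => /andP[h1 h2].
  by rewrite ltr_distl h1.
move=> xc i; rewrite !mxE.
suff : (`|x ord0 i - c ord0 i| < r)%R by rewrite ltr_distl.
apply: le_lt_trans xc; rewrite [X in (_ <= X)%R]/Num.norm/= mx_normrE.
by apply/bigmax_geP; right => /=; exists (ord0, i) => //=; rewrite !mxE.
Qed.

Lemma cube_le (c : V) r : (0 <= r)%R -> box_le (cube c r).
Proof. by move=> r0 i; rewrite /= !mxE; lra. Qed.

Lemma cube_vol (c : V) r : box_vol (cube c r) = ((2 * r) ^+ n.+1)%R.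
Proof.
rewrite /box_vol (eq_bigr (fun=> 2 * r))%R; first by rewrite prodr_const card_ord.
by move=> i _; rewrite /= !mxE; ring.
Qed.

(* Fubini in disguise: integrating the inequality [1 <= sum of indicators] one
   coordinate at a time turns the indicators of the boxes into their volumes. *)
Lemma cube_volume_le (c : V) (r : R) (k : nat -> V * V) : (0 <= r)%R ->
  (forall j, box_le (k j)) ->
  [set x : V | forall i, c ord0 i <= x ord0 i <= c ord0 i + r]%R `<=` \bigcup_j box (k j) ->
  (r ^+ n.+1)%:E <= \sum_(0 <= j <oo) (box_vol (k j))%:E.
Proof.
move=> r0 k_le kcov.
(* In the first [m] coordinates the indicator is already replaced by the side length. The case
   [m = 0] is the covering hypothesis and [m = n.+1] the claim; the step from [m] to [m + 1]
   integrates over the side of the cube in coordinate [m]. *)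
pose f m (x : V) j (i : 'I_n.+1) : R := if (i < m)%N then ((k j).2 ord0 i - (k j).1 ord0 i)%R
  else \1_(`](k j).1 ord0 i, (k j).2 ord0 i[) (x ord0 i).
have f0 m x j i : (0 <= f m x j i)%R.
  by rewrite /f; case: ifP => // _; rewrite subr_ge0 k_le.
suff main m : (m <= n.+1)%N -> forall x : V, (forall i, c ord0 i <= x ord0 i <= c ord0 i + r)%R ->
    (r ^+ m)%:E <= \sum_(0 <= j <oo) (\prod_(i < n.+1) f m x j i)%:E.
  have hc i : (c ord0 i <= c ord0 i <= c ord0 i + r)%R by rewrite lexx/= lerDl.
  apply: (le_trans (main _ (leqnn _) c hc)).
  apply: lee_nneseries => [j _ _|j _]; first by rewrite lee_fin prodr_ge0.
  by rewrite lee_fin /box_vol; apply: ler_prod => i _; rewrite f0/= /f ltn_ord.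
elim: m => [_ x xc|m IH mn x xc].
  have [j _ xk] := kcov x xc; rewrite expr0.
  apply: (@le_trans _ _ (\prod_(i < n.+1) f 0%N x j i)%:E).
    rewrite big1// => i _; rewrite /f ltn0 indicE mem_set//=.
    by rewrite in_itv/=; exact: xk.
  rewrite (@nneseriesD1 _ (fun j => (\prod_(i < n.+1) f 0%N x j i)%:E) j)//; last first.
    by move=> i _; rewrite lee_fin prodr_ge0.
  by rewrite leeDl// nneseries_ge0// => i _ _; rewrite lee_fin prodr_ge0.
pose im := Ordinal mn.
pose D := `[c ord0 im, (c ord0 im + r)%R]%classic.
have muD : lebesgue_measure D = r%:E.
  rewrite /D lebesgue_measure_itv/= lte_fin ltrDl.
  have [r00|] := ltP 0%R r; first by rewrite -EFinD; congr (_%:E); ring.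
  by move=> r00; congr (_%:E); apply/eqP; rewrite eq_le r0 r00.
pose Q j := (\prod_(i < n.+1 | i != im) f m.+1 x j i)%R.
have Q0 j : (0 <= Q j)%R by rewrite prodr_ge0.
have fupd t j : (\prod_(i < n.+1) f m (upd x im t) j i =
    Q j * \1_(`](k j).1 ord0 im, (k j).2 ord0 im[) t)%R.
  rewrite (bigD1 im)//= mulrC; congr (_ * _)%R.
    apply: eq_bigr => i im_; rewrite /f ltnS [(i <= m)%N]leq_eqVlt.
    have /negbTE -> : (i != m :> nat) by apply: contra im_ => /eqP im_; apply/eqP/val_inj.
    by rewrite /= mxE (negbTE im_).
  by rewrite /f ltnn mxE eqxx.
have mind j : measurable_fun D (fun t => (Q j * \1_(`](k j).1 ord0 im, (k j).2 ord0 im[) t)%:E).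
  by apply/measurable_EFinP; apply: measurable_funM => //; exact: measurable_indic.
have ind0 j t : 0 <= (Q j * \1_(`](k j).1 ord0 im, (k j).2 ord0 im[) t)%:E.
  by rewrite lee_fin mulr_ge0.
have le1 : \int[lebesgue_measure]_(t in D) (cst (r ^+ m)%:E) t <=
    \int[lebesgue_measure]_(t in D) \sum_(0 <= j <oo) (Q j * \1_(`](k j).1 ord0 im, (k j).2 ord0 im[) t)%:E.
  apply: ge0_le_integral => //.
  - exact: measurable_itv.
  - by move=> t _ /=; rewrite lee_fin exprn_ge0.
  - apply: ge0_emeasurable_sum => [j t _ _|j _]; [exact: ind0|exact: mind].
  - move=> t; rewrite /D/= in_itv/= => tD.
    have hc i : (c ord0 i <= upd x im t ord0 i <= c ord0 i + r)%R.
      by rewrite mxE; case: eqP => [->|].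
    apply: (le_trans (IH (ltnW mn) _ hc)).
    by apply: lee_nneseries => [j _ _|j _]; rewrite fupd.
move: le1; rewrite integral_cst; last exact: measurable_itv.
rewrite [X in _ * X](_ : _ = r%:E); last exact: muD.
rewrite -EFinM -exprSr => /le_trans; apply.
rewrite integral_nneseries; [|exact: measurable_itv|exact: mind|by move=> j t _; exact: ind0].
apply: lee_nneseries => [j _ _|j _].
  by apply: integral_ge0 => t _; exact: ind0.
rewrite (bigD1 im)//= -/(Q j) {1}/f ltnSn.
under eq_integral do rewrite EFinM.
rewrite ge0_integralZl//; last 2 first.
- by apply/measurable_EFinP; exact: measurable_indic.
- by rewrite lee_fin.
rewrite muleC EFinM lee_wpmul2r ?lee_fin//.
rewrite integral_indic//.
apply: (@le_trans _ _ (lebesgue_measure `](k j).1 ord0 im, (k j).2 ord0 im[)).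
  by apply: le_measure; rewrite ?inE//=; apply: measurableI => //; exact: measurable_itv.
rewrite lebesgue_measure_itv/= lte_fin; case: ifPn => // _.
by rewrite lee_fin subr_ge0; exact: k_le.
all: exact: measurable_itv.
Qed.

(** The cube with corner [y] and side [s] lies in the ball, since its points are at Euclidean
    distance at most [n.+1 * s = r / 2] from [y]. So every covering of the ball covers this cube. *)
Lemma lebesgue_outer_eball (y : V) (r : R) : (0 < r)%R ->
  (((r / (2 * n.+1%:R)) ^+ n.+1)%R)%:E <= mu (eball y r).
Proof.
move=> r0; set s := (r / (2 * n.+1%:R))%R.
have s0 : (0 < s)%R by rewrite divr_gt0// mulr_gt0.
rewrite lebesgue_outerE; apply: le_ereal_inf_tmp => _ [k [k_le kcov ->]].
apply: (cube_volume_le y) => //; first exact: ltW.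
apply: subset_trans kcov => x xy; rewrite /eball/= /enorm.
have hle : (\sum_(i < n.+1) (x - y)%R ord0 i ^+ 2 <= (n.+1%:R * s) ^+ 2)%R.
  apply: (@le_trans _ _ (\sum_(i < n.+1) s ^+ 2))%R.
    apply: ler_sum => i _; rewrite !mxE; have /andP[h1 h2] := xy i.
    by rewrite ler_pXn2r// ?nnegrE; lra.
  rewrite sumr_const card_ord [leRHS]exprMn -[leLHS]mulr_natl ler_wpM2r ?sqr_ge0//.
  by rewrite -natrX ler_nat -{1}(expn1 n.+1) leq_pexp2l.
have ns0 : (0 <= n.+1%:R * s)%R by rewrite mulr_ge0// ltW.
have nsr : (n.+1%:R * s < r)%R.
  have -> : (n.+1%:R * s = r / 2)%R; last by lra.
  have : (n.+1%:R != 0 :> R)%R by rewrite pnatr_eq0.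
  by rewrite /s; move: (n.+1%:R : R)%R => N N0; field.
apply: le_lt_trans nsr; rewrite -[leRHS](ger0_norm ns0) -sqrtr_sqr.
exact: ler_wsqrtr.
Qed.

End dominated.

(** * Increments along segments *)

Lemma increment_le_integral {R : realType} (phi : R -> R) (a b : R) (g : R -> \bar R) :
  a < b -> (forall t, derivable phi t 1) -> continuous (phi^`())%classic ->
  measurable_fun `[a, b]%classic g ->
  (forall t, a <= t <= b -> (`|(phi^`())%classic t|%:E <= g t)%E) ->
  (`|phi b - phi a|%:E <= \int[@lebesgue_measure R]_(t in `[a, b]%classic) g t)%E.
Proof.
move=> ab dphi cphi mg phig.
have cont t : {for t, continuous phi}.
  by apply: differentiable_continuous; apply/derivable1_diffP.
have mphi : measurable_fun `[a, b]%classic (EFin \o (phi^`())%classic).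
  apply/measurable_EFinP; apply: measurable_funTS.
  exact: continuous_measurable_fun.
have ftc : (\int[@lebesgue_measure R]_(t in `[a, b]%classic) ((phi^`())%classic t)%:E =
    (phi b)%:E - (phi a)%:E)%E.
  apply: (@continuous_FTC2 R _ phi a b ab); last by [].
    exact: continuous_subspaceT.
  split; first by move=> t _; exact: dphi.
    by apply: cvg_at_right_filter; exact: cont.
  by apply: cvg_at_left_filter; exact: cont.
rewrite -abse_EFin EFinB -ftc.
have mab : measurable (`[a, b]%classic : set R) by exact: measurable_itv.
apply: le_trans (le_abse_integral (@lebesgue_measure R) mab mphi) _.
apply: ge0_le_integral => //.
exact: measurableT_comp.
Qed.

(** * Derivatives along a line *)

Section directional_derivative.
Context {R : realType} {n : nat}.
Local Notation V := 'rV[R]_n.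
Implicit Types (u : V -> R) (x v w : V).

Lemma segment_quotient u x v (t : R) :
  (fun h : R => h^-1 *: (u (x + (h + t) *: v) - u (x + t *: v))) =
  (fun h : R => h^-1 *: ((u \o shift (x + t *: v)) (h *: v) - u (x + t *: v))).
Proof.
by apply/funext => h /=; rewrite scalerDl addrCA.
Qed.

Lemma segment_derive1 u x v t :
  ((fun s : R => u (x + s *: v))^`())%classic t = 'D_v u (x + t *: v).
Proof. by rewrite /derive1 segment_quotient. Qed.

Lemma segment_derivable u x v t : differentiable u (x + t *: v) ->
  derivable (fun s : R => u (x + s *: v)) t 1.
Proof.
move=> /(@diff_derivable _ _ _ _ _ v); rewrite /derivable -segment_quotient => h.
set F := (X in cvg (X @ _)).
suff -> : F = (fun h : R => h^-1 *: (u (x + (h + t) *: v) - u (x + t *: v))) by [].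
by apply/funext => s; rewrite /F/= [s%:A](mulr1).
Qed.

Lemma directional_derivative_sum u v w : differentiable u w ->
  'D_v u w = \sum_(i < n) v ord0 i * 'D_(evec R i) u w.
Proof.
move=> du; rewrite deriveE// {1}(row_sum_delta v) linear_sum.
by apply: eq_bigr => i _; rewrite linearZ/= deriveE.
Qed.

(** The norm of [v] is the maximum norm, which bounds each coordinate, and [grad_norm] bounds each
    partial derivative; the factor [n] counts the terms. *)
Lemma directional_derivative_le u v w : differentiable u w ->
  `|'D_v u w| <= n%:R * `|v| * grad_norm u w.
Proof.
move=> du; rewrite directional_derivative_sum//.
apply: (le_trans (ler_norm_sum _ _ _)).
apply: (@le_trans _ _ (\sum_(i < n) `|v| * grad_norm u w)).
  apply: ler_sum => i _; rewrite normrM ler_pM//.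
    rewrite [leRHS]/Num.norm/= mx_normrE.
    by apply/bigmax_geP; right => /=; exists (ord0, i).
  rewrite -sqrtr_sqr; apply: ler_wsqrtr.
  rewrite [leRHS](bigD1 i)//= lerDl; apply: sumr_ge0 => j _; exact: sqr_ge0.
by rewrite sumr_const card_ord -[leLHS]mulr_natl mulrA.
Qed.

Lemma segment_derive1_continuous u x v : (forall w, differentiable u w) ->
  (forall i, continuous (fun w => 'D_(evec R i) u w)) ->
  continuous ((fun s : R => u (x + s *: v))^`())%classic.
Proof.
move=> du cu t.
rewrite (_ : (_^`())%classic = fun t => \sum_(i < n) v ord0 i * 'D_(evec R i) u (x + t *: v)); last first.
  by apply/funext => s; rewrite segment_derive1 directional_derivative_sum.
have cline : {for t, continuous (fun t : R => x + t *: v)}.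
  apply: cvgD; first exact: cvg_cst.
  by apply: cvgZl; exact: cvg_id.
apply: cvg_big => [|i _]; first exact: add_continuous.
 apply: cvgM; first exact: cvg_cst.
by apply: (@continuous_comp _ _ _ (fun t : R => x + t *: v) (fun w => 'D_(evec R i) u w)) => //; exact: cu.
Qed.

Lemma segment_increment_le u x v (a b : R) (g : R -> \bar R) : a < b ->
  (forall w, differentiable u w) -> (forall i, continuous (fun w => 'D_(evec R i) u w)) ->
  measurable_fun `[a, b]%classic g ->
  (forall t, a <= t <= b -> ((n%:R * `|v| * grad_norm u (x + t *: v))%:E <= g t)%E) ->
  (`|u (x + b *: v) - u (x + a *: v)|%:E <= \int[@lebesgue_measure R]_(t in `[a, b]%classic) g t)%E.
Proof.
move=> ab du cu mg ug.
apply: (increment_le_integral (fun s : R => u (x + s *: v))) => // [t||t tab].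
- exact: segment_derivable.
- exact: segment_derive1_continuous.
- apply: le_trans (ug t tab); rewrite lee_fin segment_derive1.
  exact: directional_derivative_le.
Qed.

End directional_derivative.

(** * Time spent by a segment in a ball *)

Section sojourn.
Context {R : realType} {n : nat}.
Local Notation V := 'rV[R]_n.+1.

Lemma segment_ball_measurable (x v c : V) (rho : R) :
  measurable [set t : R | `|x + t *: v - c| < rho].
Proof.
apply: open_measurable.
rewrite (_ : mkset _ = (fun t : R => `|x + t *: v - c|) @^-1` [set s | s < rho])//.
apply: open_comp; last exact: open_lt.
move=> t _; apply: (@continuous_comp _ _ _ (fun t : R => x + t *: v - c) Num.norm).
  apply: cvgB; last exact: cvg_cst.
  apply: cvgD; first exact: cvg_cst.
  by apply: cvgZl; exact: cvg_id.
exact: norm_continuous.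
Qed.

Lemma subdivision_mem (f : nat -> R) (N : nat) (t : R) : f 0%N <= t -> t <= f N.+1 ->
  exists2 q, (q < N.+1)%N & f q <= t <= f q.+1.
Proof.
elim: N => [|N IH] f0t tfN; first by exists 0%N => //; rewrite f0t.
have [tN|Nt] := leP t (f N.+1).
  by have [q qN qt] := IH f0t tN; exists q => //; exact: ltnW.
by exists N.+1 => //; rewrite (ltW Nt).
Qed.

(* The time the segment from [x] to [z] spends in a ball is, as a function of [z],
   essentially a sum of indicators of cubes, one for each short time interval. *)
Lemma sojourn_dominated (x c : V) (rho a b rr : R) : 0 < rho -> 0 < a -> a < b -> 0 < rr ->
  exists h : V -> \bar R, [/\ forall z, (0 <= h z)%E,
    dominated h (((b - a) * (4 * rho / a) ^+ n.+1)%R)%:E &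
    forall z, `|z - x| < rr ->
      (\int[@lebesgue_measure R]_(t in `[a, b]%classic)
        (\1_[set t | `|x + t *: (z - x) - c| < rho]%classic t)%:E <= h z)%E].
Proof.
move=> rho0 a0 ab rr0.
(* [N] is so large that, for [z] within [rr] of [x], the moving point travels less than [rho] during
   each of the [N.+1] time steps of length [e]. *)
pose N := Num.truncn ((b - a) * rr / rho).
have hN : (b - a) * rr / rho < N.+1%:R.
  by apply: truncnS_gt.
pose e := (b - a) / N.+1%:R.
have e0 : 0 < e by rewrite divr_gt0// subr_gt0.
have err : e * rr < rho.
  rewrite /e mulrAC ltr_pdivrMr ?ltr0n//.
  by rewrite [ltRHS]mulrC -ltr_pdivrMr.
pose f q := a + q%:R * e.
have fa q : a <= f q by rewrite lerDl mulr_ge0// ltW.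
have f0 q : 0 < f q by apply: lt_le_trans (fa q).
have fS q : f q.+1 = f q + e by rewrite /f -natr1 mulrDl mul1r addrA.
have fN : f N.+1 = b by rewrite /f /e mulrC divfK ?pnatr_eq0// addrC subrK.
(* [ctr q] is the [z] for which the moving point is at [c] at time [f q]. A visit to the ball during
   step [q] puts the point within [2 * rho] of [c] at time [f q], which means that [z] is in [B q].
   As [a <= f q], the side of this cube is at most [4 * rho / a]. *)
pose ctr q := x + (f q)^-1 *: (c - x).
pose B q := box (cube (ctr q) (2 * rho / f q)).
have B0 q : 0 < 2 * rho / f q by rewrite divr_gt0// mulr_gt0.
exists (fun z => (\sum_(q < N.+1) (e%:E * (\1_(B q) z)%:E))%E); split=> [z||z zx].
- by apply: sume_ge0 => q _; rewrite mule_ge0// lee_fin ltW.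
- apply: dominated_le (dominated_sum (fun q z => (e%:E * (\1_(B q) z)%:E)%E)
    (fun=> (e * (4 * rho / a) ^+ n.+1)%:E) N.+1 _) => //.
    rewrite sumEFin lee_fin sumr_const card_ord -[leLHS]mulr_natl.
    by rewrite mulrA /e [_ * (_ / _)]mulrC divfK// pnatr_eq0.
  move=> q; apply: dominated_le (dominatedZ _ _ e (ltW e0) (dominated_box _ (cube_le (ctr q) _ (ltW (B0 q))))) => //.
  rewrite cube_vol -EFinM lee_fin ler_pM2l// ler_pXn2r ?nnegrE//.
  + have -> : 2 * (2 * rho / f q) = 4 * rho / f q by rewrite !mulrA; congr (_ * _ * _); ring.
    by rewrite ler_pM2l ?mulr_gt0// lef_pV2 ?posrE.
  + by rewrite mulr_ge0// ltW// B0.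
  + by rewrite divr_ge0 ?ltW// mulr_gt0.
- pose v := z - x; pose P q := `[f q, f q.+1]%classic : set R.
  have mP q : measurable (P q) by exact: measurable_itv.
  have mS := segment_ball_measurable x v c rho.
  have mB q : measurable_fun `[a, b]%classic (fun t => (\1_(P q) t)%:E * (\1_(B q) z)%:E : \bar R)%E.
    apply: emeasurable_funM => //; apply/measurable_EFinP.
    exact: measurable_indic.
  have mab : measurable (`[a, b]%classic : set R) by exact: measurable_itv.
  apply: (@le_trans _ _ (\int[@lebesgue_measure R]_(t in `[a, b]%classic)
      \sum_(q < N.+1) ((\1_(P q) t)%:E * (\1_(B q) z)%:E))%E).
    apply: ge0_le_integral => //.
    + apply/measurable_EFinP; exact: measurable_indic.
    + by apply: emeasurable_sum => q *; exact: mB.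
    + move=> t; rewrite /= in_itv/= => /andP[at_ tb].
      have sum0 : (0 <= \sum_(q < N.+1) ((\1_(P q) t)%:E * (\1_(B q) z)%:E : \bar R))%E.
        by apply: sume_ge0.
      rewrite indicE; case: (boolP (t \in _)) => [|_]//; rewrite inE/= => tS.
      have [q qN qt] : exists2 q, (q < N.+1)%N & f q <= t <= f q.+1.
        by apply: subdivision_mem; [rewrite /f mul0r addr0|rewrite fN].
      have zB : B q z.
        rewrite /B cubeE//=.
        have -> : z - ctr q = (f q)^-1 *: (x + f q *: v - c).
          rewrite (_ : x + _ - c = f q *: v - (c - x)); last first.
            by rewrite opprB addrA [f q *: v + x]addrC.
          by rewrite scalerBr scalerA mulVf ?gt_eqF// scale1r /ctr /v opprD addrA.
        rewrite normrZ gtr0_norm ?invr_gt0// mulrC ltr_pM2r ?invr_gt0//.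
        have -> : x + f q *: v - c = (x + t *: v - c) + (f q - t) *: v.
          by rewrite scalerBl [x + t *: v - c]addrAC -[RHS]addrA [t *: v + _]addrC subrK addrAC.
        apply: (le_lt_trans (ler_normD _ _)); rewrite normrZ.
        rewrite [ltRHS]mulrC mulrDr !mulr1 ltr_leD//.
        apply: le_trans (ltW err); rewrite ler_pM//; last exact: ltW.
        by move: qt; rewrite fS ler_norml => /andP[]; lra.
      rewrite (bigD1 (Ordinal qN))//= !indicE !mem_set//= ?in_itv//= mul1e.
      by rewrite leeDl//; apply: sume_ge0.
  rewrite ge0_integral_sum//; last by move=> q; exact: mB.
  elim/big_ind2 : _ => [//|x1 x2 y1 y2 xy1 xy2|q _]; first exact: leeD.
  under eq_integral do rewrite muleC.
  rewrite ge0_integralZl; [|exact: mab| |by []|by rewrite lee_fin]; last first.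
    by apply/measurable_EFinP; apply: measurable_indic; exact: mP.
  rewrite muleC lee_wpmul2r ?lee_fin// integral_indic//.
  apply: (@le_trans _ _ (@lebesgue_measure R (P q))).
    by apply: le_measure; rewrite ?inE//; first apply: measurableI; (exact: mP || exact: mab).
  rewrite /P lebesgue_measure_itv/= lte_fin fS; case: ifPn => _.
    by rewrite -EFinD lee_fin addrAC subrr add0r.
  by rewrite lee_fin ltW.
exact: mP.
Qed.

End sojourn.

(** * The pointwise estimate *)

Lemma eseries_geometric {R : realType} (a q : R) : 0 <= q < 1 ->
  (\sum_(0 <= i <oo) (a * q ^+ i)%:E = (a / (1 - q))%:E)%E.
Proof.
move=> /andP[q0 q1]; apply/cvg_lim => //.
rewrite (_ : (fun _ => _) = EFin \o series (geometric a q)).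
  apply: cvg_EFin; first exact: nearW.
  by apply: cvg_geometric_series; rewrite ger0_norm.
by apply/funext => n /=; rewrite -sumEFin.
Qed.

Lemma gt1_ltr_powR {R : realType} (a x y : R) : 1 < a -> x < y -> a `^ x < a `^ y.
Proof.
move=> a1 xy; have a0 : 0 < a by apply: lt_trans a1.
by rewrite /powR gt_eqF// ltr_expR ltr_pM2r// ln_gt0.
Qed.

Lemma powR_ln_ratio {R : realType} (a y : R) : 1 < a -> 0 < y -> a `^ (ln y / ln a) = y.
Proof.
move=> a1 y0; have a0 : 0 < a by apply: lt_trans a1.
by rewrite /powR gt_eqF// divfK ?lnK ?posrE// gt_eqF// ln_gt0.
Qed.

Lemma dyadic_level {R : realType} (y : R) : 0 < y ->
  exists k : int, 2 ^ k <= y < 2 ^ (k + 1).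
Proof.
move=> y0; pose L := ln y / ln 2; exists (Num.floor L).
have two1 : 1 < 2 :> R by rewrite ltr1n.
rewrite -[in X in X && _](powR_ln_ratio 2 y two1 y0) -[in X in _ && X](powR_ln_ratio 2 y two1 y0).
rewrite -!powR_intmul//; have /andP[h1 h2] := floor_itv L.
by apply/andP; split; [apply: ler_powR => //; exact: ltW|exact: gt1_ltr_powR].
Qed.

(** The covered sets are those where the gradient strictly exceeds [2 ^ k], so here the strict
    inequality has to be on the left; it comes from [dyadic_level] at [y^-1]. *)
Lemma dyadic_level_left {R : realType} (y : R) : 0 < y ->
  exists k : int, 2 ^ k < y <= 2 ^ (k + 1).
Proof.
move=> y0; have [k /andP[h1 h2]] : exists k : int, 2 ^ k <= y^-1 < 2 ^ (k + 1).
  by apply: dyadic_level; rewrite invr_gt0.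
exists (- (k + 1)); rewrite opprD addrNK -!invr_expz.
rewrite -[y]invrK; apply/andP; split.
  by rewrite -opprD -invr_expz ltf_pV2 ?posrE ?exprz_gt0 ?invr_gt0.
by rewrite lef_pV2 ?posrE ?exprz_gt0 ?invr_gt0.
Qed.

(** * Increment over one dyadic piece of a segment *)

Section scale.
Context {R : realType} {n : nat}.
Local Notation V := 'rV[R]_n.+1.

(* Up to a dimensional constant, the volume fraction of [B(x, r)] occupied by the
   balls [B(c j, rho j)]. *)
Definition ball_density (c : nat -> V) (rho : nat -> R) (x : V) (r : R) : \bar R :=
  (\sum_(0 <= j <oo) (if ((0 < rho j) && (`|x - c j| < r + rho j))%R
     then ((rho j / r) ^+ n.+1)%:E else 0))%E.

(** Gradients up to about [lam] are bounded trivially and give the constant term. At a level 2^k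
    above [lam], the time spent in the balls, integrated over [z], is controlled by their density,
    so the level costs a multiple of 2^k (lam / 2^k)^s = lam (lam / 2^k)^(s - 1). As [1 < s], these
    costs are summed by a geometric series of ratio [q]. *)
Lemma scale_increment (s : R) : 1 < s -> exists2 C : R, 0 < C &
  forall (u : V -> R) (c : int -> nat -> V) (rho : int -> nat -> R) (x : V) (rr tau lam : R),
  (forall w, differentiable u w) -> (forall i, continuous (fun w => 'D_(evec R i) u w)) ->
  (forall k w, 2 ^ k < grad_norm u w -> exists j, `|w - c k j| < rho k j) ->
  0 < rr -> 0 < tau -> 0 < lam ->
  (forall k : int, lam < 2 ^ k ->
     (ball_density (c k) (rho k) x (tau * rr) <= ((lam / 2 ^ k) `^ s)%:E)%E) ->
  exists h : V -> \bar R, [/\ forall z, (0 <= h z)%E,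
    dominated h (C * rr ^+ n.+1 * (tau * rr) * lam)%:E &
    forall z, `|z - x| < rr ->
      (`|u (x + tau *: (z - x)) - u (x + (tau / 2) *: (z - x))|%:E
        <= (C * (tau * rr) * lam)%:E + h z)%E].
Proof.
move=> s1.
pose q : R := 2 `^ (1 - s).
have q0 : 0 < q by rewrite powR_gt0.
have q1 : q < 1.
  by rewrite /q -[ltRHS](powRr0 2); apply: gt1_ltr_powR; lra.
pose C : R := n.+1%:R * 8 ^+ n.+1 / (1 - q).
have n1 : 1 <= n.+1%:R :> R by rewrite ler1n.
have C0 : 0 < C by rewrite divr_gt0 ?subr_gt0// mulr_gt0// exprn_gt0.
exists C => // u c rho x rr tau lam du cu cov rr0 tau0 lam0 dens.
have [k1 /andP[k1l k1u]] := dyadic_level _ lam0.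
(* [2 ^ k0] is the power of 2 above [lam] and at most [2 * lam], so the levels above [lam] are
   exactly the [K i]. *)
pose k0 : int := k1 + 1.
have k0lam : lam < 2 ^ k0 by [].
have k0lam2 : 2 ^ k0 <= 2 * lam.
  by rewrite /k0 expfzDr// expr1z mulrC ler_pM2l.
have tau2 : tau / 2 < tau by lra.
have tau20 : 0 < tau / 2 by lra.
pose K (i : nat) : int := k0 + i%:Z.
have KE i : 2 ^ (K i) = 2 ^ k0 * 2 ^+ i :> R by rewrite /K expfzDr.
have K0 i : 0 < 2 ^ (K i) :> R by rewrite exprz_gt0.
(* Up to time [tau] the moving point stays within [tau * rr] of [x], so only these balls can be met;
   they are the ones counted by [ball_density] at radius [tau * rr]. *)
pose active i j := (0 < rho (K i) j) && (`|x - c (K i) j| < tau * rr + rho (K i) j).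
have /choice[hs Phs] : forall ij : nat * nat, exists h : V -> \bar R,
   active ij.1 ij.2 -> [/\ forall z, (0 <= h z)%E,
    dominated h (((tau - tau / 2) * (4 * rho (K ij.1) ij.2 / (tau / 2)) ^+ n.+1)%R)%:E &
    forall z, `|z - x| < rr ->
      (\int[@lebesgue_measure R]_(t in `[(tau / 2)%R, tau]%classic)
        (\1_[set t | `|x + t *: (z - x) - c (K ij.1) ij.2| < rho (K ij.1) ij.2]%classic t)%:E <= h z)%E].
  move=> [i j]; have [act|] := boolP (active i j); last by exists (fun=> 0%E).
  have /andP[rho0 _] := act.
  have [h Ph] := sojourn_dominated x (c (K i) j) (rho (K i) j) (tau / 2) tau rr rho0 tau20 tau2 rr0.
  by exists h.
(* Bound for the derivative of [u] along the segment at points where [grad_norm u] is at most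
   [2 * 2 ^ K i]. *)
pose coef i : R := n.+1%:R * rr * (2 * 2 ^ (K i)).
have coef0 i : 0 <= coef i by rewrite /coef !mulr_ge0// ltW.
pose H i j z : \bar R := if active i j then ((coef i)%:E * hs (i, j) z)%E else 0%E.
have H0 i j z : (0 <= H i j z)%E.
  rewrite /H; case: ifP => // act; have [h0 _ _] := Phs (i, j) act.
  by rewrite mule_ge0// lee_fin.
exists (fun z => (\sum_(0 <= i <oo) \sum_(0 <= j <oo) H i j z)%E); split.
- by move=> z; apply: nneseries_ge0 => i _ _; apply: nneseries_ge0 => j _ _.
- pose v i j : \bar R := ((coef i)%:E * (if active i j then
      (((tau - tau / 2) * (4 * rho (K i) j / (tau / 2)) ^+ n.+1)%R)%:E else 0))%E.
  apply: (dominated_le _ _ _ _ (fun=> lexx _) _ (dominated_series (fun i z => (\sum_(0 <= j <oo) H i j z)%E)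
    (fun i => (\sum_(0 <= j <oo) v i j)%E) _ _)); last 2 first.
  + by move=> i z; apply: nneseries_ge0.
  + move=> i; apply: dominated_series => // j; rewrite /H /v; case: ifP => act.
      by have [_ dom _] := Phs (i, j) act; apply: dominatedZ.
    by rewrite mule0; exact: dominated0.
  apply: (@le_trans _ _ (\sum_(0 <= i <oo) ((n.+1%:R * 8 ^+ n.+1 * rr ^+ n.+1 * (tau * rr) * lam) * q ^+ i)%:E)%E).
    apply: lee_nneseries => [i _ _|i _].
      apply: nneseries_ge0 => j _ _; rewrite /v mule_ge0// ?lee_fin//.
      case: ifP => // /andP[r0 _]; rewrite lee_fin mulr_ge0//; first lra.
      by rewrite exprn_ge0// divr_ge0// ?mulr_ge0// ltW.
    have vE j : v i j = ((coef i * (tau / 2) * (8 * rr) ^+ n.+1)%:E *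
       (if active i j then ((rho (K i) j / (tau * rr)) ^+ n.+1)%:E else 0))%E.
      rewrite /v; case: ifP => act; last by rewrite !mule0.
      rewrite -!EFinM.
      have -> : 4 * rho (K i) j / (tau / 2) = 8 * rr * (rho (K i) j / (tau * rr)).
        by field; rewrite !gt_eqF.
      have -> : tau - tau / 2 = tau / 2 by field.
      by rewrite exprMn !mulrA.
    under eq_eseriesr do rewrite vE.
    rewrite nneseriesZl//; last first.
      move=> j _; case: ifP => // /andP[r0 _]; rewrite lee_fin exprn_ge0// divr_ge0// ltW//.
      exact: mulr_gt0.
    have lamK : lam < 2 ^ (K i).
      by apply: (lt_le_trans k0lam); rewrite KE ler_peMr ?exprn_ege1 ?exprz_ge0 ?ler1n.
    have := dens (K i) lamK; rewrite -/(active i _) => densK.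
    apply: (@le_trans _ _ ((coef i * (tau / 2) * (8 * rr) ^+ n.+1)%:E * ((lam / 2 ^ (K i)) `^ s)%:E)%E).
      apply: lee_wpmul2l; last exact: densK.
      by rewrite lee_fin; apply: mulr_ge0; [apply: mulr_ge0 => //|apply: exprn_ge0; apply: mulr_ge0 => //]; exact: ltW.
    rewrite -EFinM lee_fin.
    pose y := lam / 2 ^ (K i).
    have y0 : 0 <= y by rewrite divr_ge0// ltW.
    have yi : y <= 2 `^ (- i%:R).
      rewrite powR_invn// /y ler_pdivrMr// KE mulrCA mulVf ?expf_neq0// mulr1.
      exact: ltW.
    have yq : y `^ (s - 1) <= q ^+ i.
      apply: (@le_trans _ _ ((2 `^ (- i%:R)) `^ (s - 1))).
        by apply: ge0_ler_powR; rewrite ?nnegrE ?powR_ge0//; lra.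
      rewrite -powR_mulrn; last exact: powR_ge0.
      rewrite /q -!powRrM.
      by rewrite (_ : - i%:R * (s - 1) = (1 - s) * i%:R)//; ring.
    have Ky : 2 ^ (K i) * y = lam by rewrite mulrC divfK// gt_eqF.
    have s10 : 0 < s by lra.
    rewrite -/y -(mulr_powRB1 y0 s10) exprMn.
    rewrite (_ : coef i * (tau / 2) * _ * _ = n.+1%:R * 8 ^+ n.+1 * rr ^+ n.+1 * (tau * rr) *
      ((2 ^ K i * y) * y `^ (s - 1))); last by rewrite /coef; field.
    rewrite Ky [leLHS]mulrA; apply: ler_wpM2l => //.
    by rewrite !mulr_ge0 ?exprn_ge0 ?ler0n ?ltW.
  rewrite eseries_geometric; last by rewrite (ltW q0).
  rewrite lee_fin le_eqVlt; apply/orP; left; apply/eqP; rewrite /C.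
  by ring.
- move=> z zx; pose v := z - x.
  pose B i j := [set t : R | `|x + t *: v - c (K i) j| < rho (K i) j].
  pose G i j (t : R) : \bar R := (if active i j then (coef i)%:E * (\1_(B i j) t)%:E else 0)%E.
  have G0 i j t : (0 <= G i j t)%E.
    by rewrite /G; case: ifP => // _; rewrite mule_ge0// lee_fin.
  pose D := `[tau / 2, tau]%classic : set R.
  have mD : measurable D by exact: measurable_itv.
  have mInd i j : measurable_fun D (fun t => (\1_(B i j) t)%:E : \bar R).
    apply/measurable_EFinP; apply: measurable_indic; exact: segment_ball_measurable.
  have mG i j : measurable_fun D (G i j).
    rewrite /G; case: (active i j); last exact: measurable_cst.
    exact: measurable_funeM.
  have mGi i : measurable_fun D (fun t => \sum_(0 <= j <oo) G i j t)%E.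
    by apply: ge0_emeasurable_sum => [j t _ _|j _].
  have Gi0 i t : (0 <= \sum_(0 <= j <oo) G i j t)%E.
    by apply: nneseries_ge0 => j _ _.
  have mGG : measurable_fun D (fun t => \sum_(0 <= i <oo) \sum_(0 <= j <oo) G i j t)%E.
    by apply: ge0_emeasurable_sum => [i t _ _|i _].
  pose c0 : R := n.+1%:R * rr * (2 * lam).
  have c00 : 0 <= c0 by rewrite /c0 !mulr_ge0// ltW.
  apply: (le_trans (segment_increment_le u x v (tau / 2) tau
    (fun t => c0%:E + \sum_(0 <= i <oo) \sum_(0 <= j <oo) G i j t)%E tau2 du cu _ _)).
  + by apply: emeasurable_funD => //; exact: measurable_cst.
  + move=> t /andP[t1 t2].
    have vr : `|v| <= rr by exact: ltW.
    have gn0 : 0 <= grad_norm u (x + t *: v) by exact: sqrtr_ge0.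
    have [small|big] := leP (grad_norm u (x + t *: v)) (2 ^ k0).
      apply: (@le_trans _ _ c0%:E); last by rewrite leeDl// nneseries_ge0.
      rewrite lee_fin /c0; apply: ler_pM => //; first by rewrite ler_pM2l.
      exact: le_trans small _.
    have gpos : 0 < grad_norm u (x + t *: v) by apply: lt_trans big; rewrite exprz_gt0.
    have [k /andP[kl ku]] := dyadic_level_left _ gpos.
    have k0k : k0 <= k.
      have := lt_le_trans big ku; rewrite ltr_eXz2l ?ltr1n//.
      by rewrite ltzD1.
    have [i ki] : exists i, k = K i.
      by exists (absz (k - k0)); rewrite /K gez0_abs ?subr_ge0// subrKC.
    move: kl ku; rewrite ki => kl ku.
    have [j tj] := cov _ _ kl.
    have act : active i j.
      rewrite /active; apply/andP; split; first exact: le_lt_trans tj.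
      have -> : x - c (K i) j = (x + t *: v - c (K i) j) - t *: v by rewrite addrAC addrK.
      apply: (le_lt_trans (ler_normB _ _)); rewrite addrC ler_ltD// normrZ.
      rewrite ger0_norm ?(le_trans (ltW tau20))// ler_pM//.
      exact: le_trans (ltW tau20) t1.
    apply: (@le_trans _ _ (G i j t)).
      rewrite /G act indicE mem_set// mule1 lee_fin /coef.
      apply: ler_pM => //; first by rewrite ler_pM2l.
      by rewrite mulrC -[X in _ * X]expr1z -expfzDr.
    rewrite (@nneseriesD1 _ (fun i => \sum_(0 <= j <oo) G i j t)%E i)//.
    rewrite (@nneseriesD1 _ (fun j => G i j t)%E j)//.
    rewrite addeCA -addeA leeDl//.
    by rewrite !adde_ge0// ?lee_fin// nneseries_ge0.
  have GG0 t : (0 <= \sum_(0 <= i <oo) \sum_(0 <= j <oo) G i j t)%E by apply: nneseries_ge0.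
  rewrite (@ge0_integralD _ _ _ (@lebesgue_measure R) D mD (cst c0%:E)
    (fun t => \sum_(0 <= i <oo) \sum_(0 <= j <oo) G i j t)%E); last 4 first.
  + by move=> t _; rewrite lee_fin.
  + exact: measurable_cst.
  + by move=> t _.
  + exact: mGG.
  apply: leeD.
    have muD : @lebesgue_measure R D = (tau / 2)%:E.
      by rewrite /D lebesgue_measure_itv/= lte_fin tau2 -EFinD; congr EFin; field.
    rewrite integral_cst; last exact: mD.
    apply: (@le_trans _ _ (c0%:E * (tau / 2)%:E)%E).
      by apply: lee_wpmul2l; [rewrite lee_fin|rewrite -muD].
    rewrite -EFinM lee_fin /c0.
    have -> : n.+1%:R * rr * (2 * lam) * (tau / 2) = n.+1%:R * (tau * rr) * lam by field.
    apply: ler_wpM2r; first exact: ltW.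
    apply: ler_wpM2r; first by apply: mulr_ge0; exact: ltW.
    rewrite /C -[leLHS]mulr1 -mulrA; apply: ler_wpM2l; first by rewrite ler0n.
    rewrite ler_pdivlMr ?subr_gt0// mul1r (@le_trans _ _ 1)//; first by lra.
    by rewrite exprn_ege1// ler1n.
  rewrite (@integral_nneseries _ _ _ (@lebesgue_measure R) D mD (fun i t => \sum_(0 <= j <oo) G i j t)%E); last 2 first.
  + exact: mGi.
  + by move=> i t _.
  apply: lee_nneseries => [i _ _|i _].
    by apply: integral_ge0 => t _.
  rewrite (@integral_nneseries _ _ _ (@lebesgue_measure R) D mD (fun j t => G i j t)%E); last 2 first.
  + exact: mG.
  + by move=> j t _.
  apply: lee_nneseries => [j _ _|j _].
    by apply: integral_ge0 => t _.
  rewrite /G /H; have [act|act] := boolP (active i j); last by rewrite integral0_eq.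
  rewrite (@ge0_integralZl _ _ _ (@lebesgue_measure R) D mD (fun t => (\1_(B i j) t)%:E)%E); last 3 first.
  + exact: mInd.
  + by move=> t _; rewrite lee_fin.
  + by rewrite lee_fin.
  have [_ _ hB] := Phs (i, j) act.
  by apply: lee_wpmul2l; [rewrite lee_fin|exact: hB].
Qed.

End scale.

Section pointwise.
Context {R : realType} {n : nat}.
Local Notation V := 'rV[R]_n.+1.

Lemma normr_le_enorm (x : V) : `|x| <= enorm x.
Proof.
rewrite [leLHS]/Num.norm/= mx_normrE; apply: bigmax_le; first exact: sqrtr_ge0.
move=> [i j] _ /=; rewrite !ord1 -sqrtr_sqr; apply: ler_wsqrtr.
by rewrite [leRHS](bigD1 j)//= lerDl sumr_ge0// => k _; exact: sqr_ge0.
Qed.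

Lemma dist_bdry_near (O : set V) (x : V) : 0 < dist_bdry O x ->
  exists2 y, bdry O y & enorm (x - y) < 2 * dist_bdry O x.
Proof.
rewrite /dist_bdry; set S := (X in inf X) => d0.
have infS : has_inf S.
  split; last by exists 0 => _ [y _ <-]; exact: sqrtr_ge0.
  (* The infimum of the empty set is 0, so a positive distance forces a boundary point to exist. *)
  by apply/set0P/eqP => S0; move: d0; rewrite S0 inf0 ltxx.
have [_ [y yO <-] yd] := inf_adherent d0 infS.
by exists y => //; apply: lt_le_trans yd _; lra.
Qed.

(** The points x + 2^-m (z - x) start at [z] and tend to [x]; the increments between them telescope,
    and continuity of [u] at [x] gives the limit. *)
Lemma dyadic_telescope (u : V -> R) (x z : V) (a : nat -> \bar R) :
  {for x, continuous u} -> (forall m, 0 <= a m)%E ->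
  (forall m, (`|u (x + (2^-1 ^+ m) *: (z - x)) - u (x + (2^-1 ^+ m.+1) *: (z - x))|%:E <= a m)%E) ->
  (`|u x - u z|%:E <= \sum_(0 <= m <oo) a m)%E.
Proof.
move=> cu a0 ha; pose F m := u (x + (2^-1 ^+ m) *: (z - x)).
have F0 : F 0%N = u z by rewrite /F expr0 scale1r subrKC.
have FM M : (`|F M - u z|%:E <= \sum_(0 <= m <oo) a m)%E.
  apply: (@le_trans _ _ (\sum_(0 <= m < M) a m)%E); last exact: nneseries_lim_ge.
  rewrite big_mkord; elim: M => [|M IH]; first by rewrite F0 subrr normr0 big_ord0.
  rewrite big_ord_recr/=; apply: le_trans (leeD IH (ha M)).
  rewrite -EFinD lee_fin [leRHS]addrC [X in _ <= X + _]distrC; exact: ler_distD.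
have FX : F @ \oo --> u x.
  have hx : (fun m => x + (2^-1 ^+ m) *: (z - x)) @ \oo --> x + (0 : R) *: (z - x).
    apply: cvgD; first exact: cvg_cst.
    apply: cvgZr_tmp; apply: cvg_expr.
    by rewrite ger0_norm ?invr_ge0// invf_lt1// ltr1n.
  rewrite scale0r addr0 in hx.
  exact: (cvg_comp _ _ hx cu).
have [tot|] := leP (\sum_(0 <= m <oo) a m)%E +oo%E; last by rewrite ltNge leey.
move: FM; case: (\sum_(0 <= m <oo) a m)%E => [t FM||].
- rewrite lee_fin.
  have cvgN : (fun M => `|F M - u z|) @ \oo --> `|u x - u z|.
    by apply: cvg_norm; apply: cvgB => //; exact: cvg_cst.
  apply: (cvgr_to_le cvgN).
  by apply: nearW => M; have := FM M; rewrite lee_fin.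
- by rewrite leey.
- by move=> /(_ 0%N); rewrite leeNy_eq.
Qed.

Lemma pointwise_hardy (s kappa b : R) : 1 < s -> 0 <= kappa -> kappa < 1 -> 0 < b ->
  exists2 C : R, 0 < C &
  forall (O : set V) (u : V -> R) (c : int -> nat -> V) (rho : int -> nat -> R) (x : V) (T : R),
  (forall w, differentiable u w) -> (forall i, continuous (fun w => 'D_(evec R i) u w)) ->
  (forall k w, 2 ^ k < grad_norm u w -> exists j, `|w - c k j| < rho k j) ->
  (forall w, ~ O w -> u w = 0) -> outer_regular O b -> 0 < dist_bdry O x -> 0 < T ->
  (forall (k : int) (r : R), 0 < r -> T < 2 ^ k * r `^ kappa ->
     (ball_density (c k) (rho k) x r <= ((T / (2 ^ k * r `^ kappa)) `^ s)%:E)%E) ->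
  `|u x| <= C * T * dist_bdry O x `^ (1 - kappa).
Proof.
move=> s1 kappa0 kappa1 b0.
have [CD CD0 scale] := @scale_increment R n s s1.
(* Ratio of the series over the scales r = [tau m * rr], whose terms are multiples of r^(1 -
   kappa). *)
pose q : R := (2^-1) `^ (1 - kappa).
have q0 : 0 < q by rewrite powR_gt0// invr_gt0.
have q1 : q < 1.
  rewrite /q -powR_inv1// -powRrM -[ltRHS](powRr0 2); apply: gt1_ltr_powR; lra.
pose C1 : R := CD * 4 `^ (1 - kappa) / (1 - q).
have C10 : 0 < C1 by rewrite divr_gt0 ?subr_gt0// mulr_gt0// powR_gt0.
pose C2 : R := 2 * (4 * n.+1%:R) ^+ n.+1 / b.
have C20 : 0 < C2 by rewrite divr_gt0// mulr_gt0// exprn_gt0// mulr_gt0.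
exists ((2 + C2) * C1); first by rewrite mulr_gt0// addr_gt0.
move=> O u c rho x T du cu cov u0 regO d0 T0 dens; set d := dist_bdry O x in d0 *.
have [y yO xyd] := dist_bdry_near _ _ d0; rewrite -/d in xyd.
(* As [y] is within [2 * d] of [x], this radius around [x] contains the ball of radius [2 * d]
   around [y]. *)
pose rr := 4 * d.
have rr0 : 0 < rr by rewrite mulr_gt0.
pose tau m : R := 2^-1 ^+ m.
have tau0 m : 0 < tau m by rewrite exprn_gt0// invr_gt0.
have tauS m : tau m / 2 = tau m.+1 by rewrite /tau exprSr.
(* With this [lam], the condition [lam m < 2 ^ k] is T < 2^k r^kappa at the scale r = [tau m * rr],
   and the density bounds of the two hypotheses agree. *)
pose lam m := T / (tau m * rr) `^ kappa.
have r0 m : 0 < tau m * rr by rewrite mulr_gt0.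
have rk0 m : 0 < (tau m * rr) `^ kappa by rewrite powR_gt0.
have lam0 m : 0 < lam m by rewrite divr_gt0.
have /choice[h Ph] : forall m, exists h : V -> \bar R, [/\ forall z, (0 <= h z)%E,
    dominated h (CD * rr ^+ n.+1 * (tau m * rr) * lam m)%:E &
    forall z, `|z - x| < rr ->
      (`|u (x + tau m *: (z - x)) - u (x + (tau m / 2) *: (z - x))|%:E
        <= (CD * (tau m * rr) * lam m)%:E + h z)%E].
  move=> m; apply: (scale u c rho) => // k lamk.
  have -> : lam m / 2 ^ k = T / (2 ^ k * (tau m * rr) `^ kappa).
    by rewrite /lam invfM; ring.
  apply: dens => //; by rewrite -ltr_pdivrMr.
have lamE m : tau m * rr * lam m = T * rr `^ (1 - kappa) * q ^+ m.
  have x0 : tau m * rr != 0 by rewrite gt_eqF.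
  have -> : tau m * rr * lam m = T * (tau m * rr) `^ (1 - kappa).
    rewrite powRB; last by rewrite x0 implybT.
    by rewrite powRr1 ?(ltW (r0 m))// /lam; ring.
  have tq : tau m `^ (1 - kappa) = q ^+ m.
    by rewrite /tau -[2^-1 ^+ m]powR_mulrn ?invr_ge0 ?ler0n// powRAC powR_mulrn ?powR_ge0.
  rewrite powRM ?(ltW (tau0 m)) ?(ltW rr0)// tq; ring.
have v0 m : 0 <= CD * (tau m * rr) * lam m.
  by apply: mulr_ge0; [apply: mulr_ge0|]; exact: ltW.
pose S := C1 * T * d `^ (1 - kappa).
have S0 : 0 < S by apply: mulr_gt0; [exact: mulr_gt0|exact: powR_gt0].
have SE : (\sum_(0 <= m <oo) (CD * (tau m * rr) * lam m)%:E = S%:E)%E.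
  rewrite (_ : S = (CD * T * rr `^ (1 - kappa)) / (1 - q)); last first.
    by rewrite /S /C1 /rr powRM ?ltW//; ring.
  rewrite -eseries_geometric ?(ltW q0)//; apply: eq_eseriesr => m _.
  by congr EFin; transitivity (CD * (tau m * rr * lam m)); [rewrite !mulrA|rewrite lamE !mulrA].
have domh : dominated (fun z => \sum_(0 <= m <oo) h m z)%E (rr ^+ n.+1 * S)%:E.
  apply: (dominated_le _ _ _ _ (fun=> lexx _) _ (dominated_series h
    (fun m => (CD * rr ^+ n.+1 * (tau m * rr) * lam m)%:E) _ _)).
  - rewrite EFinM -SE -nneseriesZl; last first.
      by move=> m _; rewrite lee_fin v0.
    rewrite le_eqVlt; apply/orP; left; apply/eqP; apply: eq_eseriesr => m _.
    by rewrite -EFinM; congr EFin; ring.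
  - by move=> m z; have [] := Ph m.
  - by move=> m; have [] := Ph m.
have -> : (2 + C2) * C1 * T * d `^ (1 - kappa) = (2 + C2) * S by rewrite /S !mulrA.
(* If |u x| exceeds [2 * S], then for each [z] in [A], where [u] vanishes, the sum of the [h m z] is
   at least |u x| - S, hence at least half of |u x|. Markov's inequality and the lower bound on the
   measure of [A] then give |u x| <= C2 S. *)
have [le2S|gt2S] := leP `|u x| (2 * S).
  by rewrite (le_trans le2S)// ler_pM2r// lerDl ltW.
pose A := eball y (2 * d) `\` O.
have Ah z : A z -> ((`|u x| / 2)%:E <= \sum_(0 <= m <oo) h m z)%E.
  move=> [zy zO].
  have zx : `|z - x| < rr.
    rewrite -(subrKA y z); apply: (le_lt_trans (ler_normD _ _)).
    have h1 := normr_le_enorm (z - y); have h2 := normr_le_enorm (x - y).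
    by rewrite (distrC y x) /rr; move: zy; rewrite /eball/=; lra.
  have := dyadic_telescope u x z (fun m => (CD * (tau m * rr) * lam m)%:E + h m z)%E.
  rewrite (u0 z zO) subr0 nneseriesD; last 2 first.
  - by move=> m _ _; rewrite lee_fin v0.
  - by move=> m _ _; have [] := Ph m.
  rewrite SE => tele.
  have {}tele : (`|u x|%:E <= S%:E + \sum_(0 <= m <oo) h m z)%E.
    apply: tele => [||m].
    - exact: differentiable_continuous.
    - move=> m; apply: adde_ge0; last by have [] := Ph m.
      by rewrite lee_fin v0.
    - by have [_ _ hm] := Ph m; have := hm z zx; rewrite tauS.
  apply: (@le_trans _ _ (`|u x| - S)%:E); first by rewrite lee_fin; lra.
  by rewrite EFinB leeBlDl.
have uS : 0 <= `|u x| / 2 by rewrite divr_ge0.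
have le1 := dominated_markov _ _ A (`|u x| / 2) uS domh Ah.
have d20 : 0 < 2 * d by rewrite mulr_gt0.
have le2 := lebesgue_outer_eball y (2 * d) d20.
have le3 := regO y yO (2 * d) d20.
pose w := (2 * d / (2 * n.+1%:R)) ^+ n.+1.
have w0 : 0 < w by rewrite exprn_gt0// divr_gt0// mulr_gt0.
have : ((`|u x| / 2 * (b * w))%:E <= (rr ^+ n.+1 * S)%:E)%E.
  apply: le_trans le1; rewrite EFinM; apply: lee_wpmul2l; first by rewrite lee_fin.
  apply: le_trans le3; rewrite EFinM; apply: lee_wpmul2l; last exact: le2.
  by rewrite lee_fin ltW.
have -> : rr ^+ n.+1 = (4 * n.+1%:R) ^+ n.+1 * w.
  rewrite /w -exprMn; congr (_ ^+ _); rewrite /rr.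
  have : (n.+1%:R != 0 :> R) by rewrite pnatr_eq0.
  by move: (n.+1%:R : R) => N N0; field.
rewrite lee_fin => le4.
have le5 : `|u x| <= C2 * S.
  rewrite /C2 mulrAC ler_pdivlMr// -(ler_pM2r w0).
  by move: le4; set Z := _ ^+ _; lra.
by rewrite (le_trans le5)// ler_pM2r// lerDr.
Qed.

End pointwise.

(** * Heavy dyadic cubes *)

Section dyadic_covering.
Context {R : realType} {n : nat} (c : nat -> 'rV[R]_n.+1) (rho : nat -> R) (delta K : R).
Local Notation V := 'rV[R]_n.+1.
Hypothesis delta0 : 0 < delta.
Hypothesis rho0 : forall j, 0 <= rho j.
Hypothesis K0 : 0 < K.
Hypothesis rho_fin : (\sum_(0 <= j <oo) (rho j `^ delta)%:E < +oo)%E.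

(** Integer coordinates of the half-open dyadic cube of side [2 ^ m] containing [x]. Cubes do not
    appear as sets: any point of a cube represents it, through [same_cube]. *)
Definition dyadic_index (m : int) (x : V) (a : 'I_n.+1) : int := Num.floor (x ord0 a / 2 ^ m).

Definition same_cube (m : int) (x y : V) : Prop :=
  forall a, dyadic_index m x a = dyadic_index m y a.

Lemma same_cube_sym m x y : same_cube m x y -> same_cube m y x.
Proof. by move=> h a; rewrite h. Qed.

Lemma same_cube_trans m x y z : same_cube m x y -> same_cube m y z -> same_cube m x z.
Proof. by move=> h h' a; rewrite h. Qed.

(** This makes the dyadic grids nested: the index at side [2 ^ (m + 1)] is determined by the index
    at side [2 ^ m]. *)
Lemma floor_half (t : R) : Num.floor (t / 2) = (Num.floor t %/ 2)%Z.
Proof.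
have [q [e [fE -> e0 e2]]] : exists q e : int,
    [/\ Num.floor t = q * 2 + e, (Num.floor t %/ 2)%Z = q, 0 <= e & e < 2].
  exists (Num.floor t %/ 2)%Z, (Num.floor t %% 2)%Z.
  by split; [exact: divz_eq|by []|exact: modz_ge0|exact: ltz_pmod].
apply: floor_def; have /andP[] := floor_itv t.
have e0R : 0 <= e%:~R :> R by rewrite ler0z.
have e1R : e%:~R <= 1 :> R by rewrite -[1]/(1%:~R) ler_int -ltzD1.
have two : 2%:~R = 2 :> R by [].
rewrite fE !intrD intrM two => h1 h2.
by rewrite ler_pdivlMr// ltr_pdivrMr//; apply/andP; split; lra.
Qed.

Lemma same_cubeS m x y : same_cube m x y -> same_cube (m + 1) x y.
Proof.
move=> h a; have := h a; rewrite /dyadic_index expfzDr// expr1z invfM !mulrA.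
by rewrite !floor_half => ->.
Qed.

Lemma same_cube_le m m' x y : m <= m' -> same_cube m x y -> same_cube m' x y.
Proof.
move=> mm' h; have -> : m' = m + (absz (m' - m))%:Z by rewrite gez0_abs ?subr_ge0// subrKC.
elim: (absz _) => [|k IH]; first by rewrite addr0.
by rewrite -addn1 PoszD addrA; exact: same_cubeS.
Qed.

Lemma same_cube_dist m x y : same_cube m x y -> `|x - y| <= 2 ^ m.
Proof.
move=> h; have m0 : 0 < 2 ^ m :> R by rewrite exprz_gt0.
rewrite [leLHS]/Num.norm/= mx_normrE; apply: bigmax_le; first exact: ltW.
move=> [i a] _ /=; rewrite !ord1 !mxE.
have := h a; rewrite /dyadic_index => fE.
have /andP[h1 h2] := floor_itv (x ord0 a / 2 ^ m).
have /andP[h3 h4] := floor_itv (y ord0 a / 2 ^ m).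
move: h1 h2; rewrite fE => h1 h2; move: h2 h4; rewrite !intrD => h2 h4.
have : `|x ord0 a / 2 ^ m - y ord0 a / 2 ^ m| <= 1 by rewrite ler_norml; apply/andP; split; lra.
by rewrite -mulrBl normrM [`|(2 ^ m)^-1|]gtr0_norm ?invr_gt0// ler_pdivrMr// mul1r.
Qed.

Definition cube_mass (x : V) (m : int) : \bar R :=
  (\sum_(0 <= i <oo) (if `[< same_cube m (c i) x >] then (rho i `^ delta)%:E else 0))%E.

(** In a heavy cube, all the balls centred there may be traded for a single ball of the size of the
    cube, at the cost of a factor [K] in the sum of the powers [delta] of the radii. *)
Definition heavy (x : V) (m : int) : Prop := (((2 ^ m) `^ delta)%:E <= K%:E * cube_mass x m)%E.

Lemma cube_mass_same m x y : same_cube m x y -> cube_mass x m = cube_mass y m.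
Proof.
move=> xy; apply: eq_eseriesr => i _; congr (if _ then _ else _).
apply: asbool_equiv_eq; split=> h; first exact: same_cube_trans xy.
exact: same_cube_trans (same_cube_sym _ _ _ xy).
Qed.

Lemma heavy_same m x y : same_cube m x y -> heavy x m -> heavy y m.
Proof. by rewrite /heavy => /cube_mass_same ->. Qed.

(** No cube has more mass than the finite total sum, which bounds the side of a heavy cube. This is
    why maximal heavy cubes exist. *)
Lemma heavy_bounded : exists M0 : int, forall x m, heavy x m -> m <= M0.
Proof.
pose S := fine (\sum_(0 <= j <oo) (rho j `^ delta)%:E)%E.
have S0 : (0 <= \sum_(0 <= j <oo) (rho j `^ delta)%:E)%E.
  by apply: nneseries_ge0 => j _ _; rewrite lee_fin powR_ge0.
have SE : (\sum_(0 <= j <oo) (rho j `^ delta)%:E = S%:E)%E by rewrite fineK// ge0_fin_numE.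
have S0R : 0 <= S by rewrite -lee_fin -SE.
have KS0 : 0 < K * S + 1 by rewrite ltr_wpDl// mulr_ge0// ltW.
have [k /andP[_ k2]] := dyadic_level ((K * S + 1) `^ delta^-1) (powR_gt0 _ KS0).
exists (k + 1) => x m; rewrite /heavy => hm.
have : (((2 ^ m) `^ delta)%:E <= (K * S)%:E)%E.
  apply: (le_trans hm); rewrite EFinM -SE; apply: lee_wpmul2l; first by rewrite lee_fin ltW.
  apply: lee_nneseries => [i _ _|i _]; case: ifP => // _; rewrite ?lee_fin powR_ge0//.
rewrite lee_fin => le1.
have : (2 : R) ^ m < 2 ^ (k + 1).
  apply: le_lt_trans k2.
  have -> : (2 : R) ^ m = ((2 ^ m) `^ delta) `^ delta^-1.
    by rewrite -powRrM mulfV ?lt0r_neq0// powRr1 ?exprz_ge0.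
  apply: ge0_ler_powR; rewrite ?nnegrE ?powR_ge0//; [|exact: ltW|lra].
  by rewrite invr_ge0 ltW.
by rewrite ltr_eXz2l ?ltr1n// => /ltW.
Qed.

Lemma heavy_max x : exists M : int, (exists m, heavy x m) ->
  heavy x M /\ forall m, heavy x m -> m <= M.
Proof.
have [[m hm]|nh] := pselect (exists m, heavy x m); last by exists 0.
have [M0 hM0] := heavy_bounded.
(* The largest heavy level is found by searching downwards from the bound [M0]. *)
pose P k := `[< heavy x (M0 - k%:Z) >].
have exP : exists k, P k.
  exists (absz (M0 - m)); apply/asboolP; rewrite gez0_abs ?subr_ge0; last exact: hM0 hm.
  by rewrite opprB subrKC.
exists (M0 - (ex_minn exP)%:Z) => _; case: ex_minnP => k /asboolP Pk mink.
split=> // m' hm'; have m'M0 := hM0 _ _ hm'.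
have : P (absz (M0 - m')) by apply/asboolP; rewrite gez0_abs ?subr_ge0// opprB subrKC.
move=> /mink; rewrite -lez_nat gez0_abs ?subr_ge0// => kM; lra.
Qed.

(* A maximal heavy cube is labelled by the least index [j] of a center lying in it, so that
   the selected cubes are indexed by a subset [J] of nat; [2 ^ M j] is their side length. *)
Lemma heavy_selection : exists (J : nat -> Prop) (M : nat -> int),
  (\sum_(0 <= j <oo) (if `[< J j >] then ((2 ^ M j) `^ delta)%:E else 0)
     <= K%:E * \sum_(0 <= j <oo) (rho j `^ delta)%:E)%E /\
  forall j m, heavy (c j) m -> exists j', [/\ J j', m <= M j' & same_cube (M j') (c j) (c j')].
Proof.
have /choice[M PM] := fun j => heavy_max (c j).
pose D j := exists m, heavy (c j) m.
pose J j := D j /\ forall i, (i < j)%N -> D i -> M i = M j -> ~ same_cube (M j) (c i) (c j).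
exists J, M; split; last first.
  move=> j m hm; have Dj : D j by exists m.
  pose P i := `[< [/\ D i, M i = M j & same_cube (M j) (c j) (c i)] >].
  have exP : exists i, P i by exists j; apply/asboolP; split.
  case: (ex_minnP exP) => j' /asboolP[Dj' MM' sj'] minj'.
  exists j'; rewrite MM'; split=> //; last by have [_ h] := PM j Dj; exact: h.
  split=> // i ij' Di Mi si; have : P i.
    apply/asboolP; split=> //; first by rewrite Mi.
    by apply: same_cube_trans sj' _; apply: same_cube_sym; rewrite -MM'.
  by move=> /minj'; rewrite leqNgt ij'.
(* Two selected cubes containing the same [c i] are nested; maximality makes them equal, and
   minimality of the label makes the labels equal. So each [rho i] is counted at most once in the
   double sum below. *)
have uniqJ i j j' : J j -> J j' -> same_cube (M j) (c i) (c j) -> same_cube (M j') (c i) (c j') -> j = j'.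
  wlog : j j' / M j <= M j'.
    move=> H Jj Jj' s s'; have [le|/ltW le] := leP (M j) (M j'); first exact: H.
    by apply/esym; exact: H.
  move=> le [Dj minj] [Dj' minj'] s s'.
  have sjj' : same_cube (M j') (c j) (c j').
    apply: same_cube_trans s'; apply: same_cube_sym; exact: same_cube_le s.
  have [hj' _] := PM j' Dj'; have [_ maxj] := PM j Dj.
  have le' : M j' <= M j by apply: maxj; apply: heavy_same hj'; exact: same_cube_sym.
  have MM : M j = M j' by apply/eqP; rewrite eq_le le le'.
  have [jj'|j'j|//] := ltngtP j j'; first by have := minj' _ jj' Dj MM sjj'.
  by have := minj _ j'j Dj' (esym MM); rewrite MM; case; exact: same_cube_sym.
pose a j i : \bar R := if `[< J j /\ same_cube (M j) (c i) (c j) >] then (rho i `^ delta)%:E else 0%E.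
have a0 j i : (0 <= a j i)%E by rewrite /a; case: ifP => // _; rewrite lee_fin powR_ge0.
apply: (@le_trans _ _ (\sum_(0 <= j <oo) (K%:E * \sum_(0 <= i <oo) a j i))%E).
  apply: lee_nneseries => [j _ _|j _]; first by case: ifP => // _; rewrite lee_fin powR_ge0.
  case: ifP => [/asboolP Jj|_]; last first.
    by rewrite mule_ge0 ?lee_fin ?(ltW K0)//; apply: nneseries_ge0.
  have [hj _] := PM j (proj1 Jj); apply: (le_trans hj).
  apply: lee_wpmul2l; first by rewrite lee_fin ltW.
  apply: lee_nneseries => [i _ _|i _]; first by case: ifP => // _; rewrite lee_fin powR_ge0.
  by case: ifP => [/asboolP sij|_]; [rewrite /a ifT//; apply/asboolP|exact: a0].
rewrite nneseriesZl; last by move=> j _; apply: nneseries_ge0.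
apply: lee_wpmul2l; first by rewrite lee_fin ltW.
rewrite nneseries_interchange//; apply: lee_nneseries => [i _ _|i _].
  by apply: nneseries_ge0.
have [[j [Jj sij]]|none] := pselect (exists j, J j /\ same_cube (M j) (c i) (c j)).
  rewrite (@nneseriesD1 _ (fun j => a j i) j)// eseries0 ?adde0.
    by rewrite /a ifT//; apply/asboolP.
  move=> k _ kj; rewrite /a ifF//; apply/negbTE/asboolPn => -[Jk sik].
  by move: kj; rewrite (uniqJ i k j)// eqxx.
rewrite eseries0; first by rewrite lee_fin powR_ge0.
by move=> k _ _; rewrite /a ifF//; apply/negbTE/asboolPn => h; apply: none; exists k.
Qed.

End dyadic_covering.

(** * From high density to a heavy cube *)

Section density_heavy.
Context {R : realType} {n : nat} (c : nat -> 'rV[R]_n.+1) (rho : nat -> R) (delta nu K : R).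
Local Notation V := 'rV[R]_n.+1.
Hypothesis delta0 : 0 < delta.
Hypothesis deltan : delta <= n.+1%:R.
Hypothesis rho0 : forall j, 0 <= rho j.
Hypothesis nu0 : 0 < nu.
Hypothesis nu1 : nu <= 1.
Hypothesis KE : K = 8 `^ delta * 2 ^+ n.+1 / nu `^ (delta / n.+1%:R).

Let n0 : 0 < n.+1%:R :> R. Proof. by rewrite ltr0n. Qed.

Let nud0 : 0 < nu `^ (delta / n.+1%:R). Proof. exact: powR_gt0. Qed.

Let K0 : 0 < K.
Proof. by rewrite KE divr_gt0// mulr_gt0 ?powR_gt0 ?exprn_gt0. Qed.

Lemma rho_le_mass j m : ((rho j `^ delta)%:E <= cube_mass c rho delta (c j) m)%E.
Proof.
rewrite /cube_mass (@nneseriesD1 _ _ j)//; last first.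
  by move=> i _; case: ifP => // _; rewrite lee_fin powR_ge0.
rewrite ifT; last by apply/asboolP.
rewrite leeDl// nneseries_ge0// => i _ _.
by case: ifP => // _; rewrite lee_fin powR_ge0.
Qed.

Let eight_le_K : 2 `^ delta <= K.
Proof.
rewrite KE ler_pdivlMr//.
apply: (@le_trans _ _ (8 `^ delta * 1)).
  apply: ler_pM; rewrite ?powR_ge0//.
    by apply: ge0_ler_powR; rewrite ?nnegrE ?(ltW delta0)// ler_nat.
  rewrite -[leRHS](powRr0 nu); apply: ger_powR; first by rewrite nu0.
  by rewrite divr_ge0 ?ltW.
by rewrite ler_pM2l ?powR_gt0// exprn_ege1// ler1n.
Qed.

(** The ball [j] alone makes a cube of side less than [2 * rho j] heavy, since [K] is at least
    2^delta. *)
Lemma big_ball_heavy j : 0 < rho j -> exists m, heavy c rho delta K (c j) m /\ rho j <= 2 ^ m.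
Proof.
move=> rj0; have [k /andP[k1 k2]] := dyadic_level_left _ rj0.
exists (k + 1); split=> //; rewrite /heavy.
apply: (@le_trans _ _ (K%:E * (rho j `^ delta)%:E)%E); last first.
  by apply: lee_wpmul2l; [rewrite lee_fin ltW|exact: rho_le_mass].
rewrite -EFinM lee_fin expfzDr// expr1z mulrC powRM ?exprz_ge0//.
apply: ler_pM; rewrite ?powR_ge0//.
by apply: ge0_ler_powR; rewrite ?nnegrE ?exprz_ge0 ?(ltW delta0) ?(ltW rj0)// ltW.
Qed.

Definition active (x : V) (r : R) j := (0 < rho j) && (`|x - c j| < r + rho j).

(* If the sum on the right were at most [Y^delta], with [Y^n = nu r^n], then every [rho j]
   would be at most [Y], and [rho j ^ n <= Y^(n - delta) rho j ^ delta] would sum to at most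
   [nu r^n]. *)
Lemma density_mass (x : V) (r : R) : 0 < r -> (nu%:E < ball_density c rho x r)%E ->
  ((nu `^ (delta / n.+1%:R) * r `^ delta)%:E <
    \sum_(0 <= j <oo) (if active x r j then (rho j `^ delta)%:E else 0))%E.
Proof.
move=> r0 dens; rewrite ltNge; apply/negP => small.
pose Y := nu `^ (n.+1%:R^-1) * r.
have Y0 : 0 < Y by rewrite mulr_gt0// powR_gt0.
have Yd : nu `^ (delta / n.+1%:R) * r `^ delta = Y `^ delta.
  by rewrite /Y powRM ?powR_ge0 ?(ltW r0)// -powRrM [_^-1 * _]mulrC.
have Yn : Y ^+ n.+1 = nu * r ^+ n.+1.
  rewrite /Y exprMn -[(nu `^ _) ^+ _]powR_mulrn ?powR_ge0// -powRrM mulVf ?gt_eqF// powRr1//.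
  exact: ltW.
rewrite Yd in small.
have term0 j : (0 <= (if active x r j then (rho j `^ delta)%:E else 0 : \bar R))%E.
  by case: ifP => // _; rewrite lee_fin powR_ge0.
have rhoY j : active x r j -> rho j <= Y.
  move=> act; have rj0 : 0 < rho j by case/andP: act.
  have : ((rho j `^ delta)%:E <= (Y `^ delta)%:E)%E.
    apply: le_trans small; rewrite (@nneseriesD1 _ _ j)// act leeDl//.
    by apply: nneseries_ge0 => i _ _.
  rewrite lee_fin => le1; rewrite leNgt; apply/negP => Yr.
  by move: le1; rewrite leNgt gt0_ltr_powR ?nnegrE ?(ltW Y0) ?(ltW rj0).
have : (ball_density c rho x r <= nu%:E)%E; last by rewrite leNgt dens.
apply: (@le_trans _ _ (\sum_(0 <= j <oo) ((Y `^ (n.+1%:R - delta) / r ^+ n.+1)%:E *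
    (if active x r j then (rho j `^ delta)%:E else 0)))%E).
  apply: lee_nneseries => [j _ _|j _].
    case: ifP => // /andP[rj0 _]; rewrite lee_fin exprn_ge0// divr_ge0 ?ltW//.
  rewrite -/(active x r j); case: ifP => [act|_]; last by rewrite mule0.
  have rj0 : 0 < rho j by case/andP: act.
  rewrite -EFinM lee_fin expr_div_n mulrAC ler_pM2r ?invr_gt0 ?exprn_gt0//.
  rewrite -powR_mulrn ?(ltW rj0)// -{1}(subrK delta n.+1%:R) powRD; last first.
    by rewrite (gt_eqF rj0) implybT.
  rewrite ler_pM2r ?powR_gt0//; apply: ge0_ler_powR; rewrite ?nnegrE ?subr_ge0//.
  - exact: ltW.
  - exact: rhoY.
rewrite nneseriesZl//.
apply: (@le_trans _ _ ((Y `^ (n.+1%:R - delta) / r ^+ n.+1)%:E * (Y `^ delta)%:E)%E).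
  by apply: lee_wpmul2l => //; rewrite lee_fin divr_ge0 ?powR_ge0 ?exprn_ge0 ?(ltW r0).
rewrite -EFinM lee_fin mulrAC -powRD; last by rewrite (gt_eqF Y0) implybT.
by rewrite subrK powR_mulrn ?(ltW Y0)// Yn mulfK// expf_neq0// gt_eqF.
Qed.

(** If some active ball has radius at least [r], then [big_ball_heavy] suffices. Otherwise all
    active centres are within [2 * r] of [x], hence in at most 2^(n+1) cubes of side [2 ^ m] between
    [4 * r] and [8 * r], and by pigeonhole one of these carries its share of the mass given by
    [density_mass]. This explains the factors 8^delta and 2^(n+1) of [K]. *)
Lemma density_heavy (x : V) (r : R) : 0 < r -> (nu%:E < ball_density c rho x r)%E ->
  exists j m, [/\ heavy c rho delta K (c j) m, r <= 2 ^ m & `|x - c j| < 2 * 2 ^ m].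
Proof.
move=> r0 dens.
have [[j [act rj]]|small] := pselect (exists j, active x r j /\ r <= rho j).
  have /andP[rj0 xj] := act; have [m [hm rm]] := big_ball_heavy _ rj0.
  exists j, m; split=> //; first exact: le_trans rm.
  by apply: (lt_le_trans xj); rewrite mulr_natl mulr2n lerD// (le_trans rj).
have near j : active x r j -> `|x - c j| < 2 * r.
  move=> act; have /andP[rj0 xj] := act; apply: (lt_trans xj).
  have : rho j < r by rewrite ltNge; apply/negP => rj; apply: small; exists j.
  lra.
have r40 : 0 < 4 * r by rewrite mulr_gt0.
have [k /andP[k1 k2]] := dyadic_level_left _ r40.
pose m := k + 1; have m0 : 0 < 2 ^ m :> R by rewrite exprz_gt0.
have mE : 2 ^ m = 2 * 2 ^ k :> R by rewrite /m expfzDr// expr1z mulrC.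
(* In direction [a] the centres range over an interval of length [4 * r], at most [2 ^ m], so their
   index is [f a] or [f a + 1]. The pattern [pat j] records which one for every direction, so equal
   patterns mean equal cubes. *)
pose f a := Num.floor ((x ord0 a - 2 * r) / 2 ^ m).
pose pat j : {ffun 'I_n.+1 -> bool} := [ffun a => dyadic_index m (c j) a == f a].
have pat_same i j : active x r i -> active x r j -> pat i = pat j -> same_cube m (c i) (c j).
  move=> acti actj ij a.
  have cases l : active x r l -> dyadic_index m (c l) a = f a \/ dyadic_index m (c l) a = f a + 1.
    move=> actl; have xl := near l actl.
    have : `|x ord0 a - c l ord0 a| < 2 * r.
      apply: le_lt_trans xl; rewrite [leRHS]/Num.norm/= mx_normrE.
      by apply/bigmax_geP; right => /=; exists (ord0, a) => //=; rewrite !mxE.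
    rewrite ltr_norml => /andP[h1 h2].
    have lo : f a <= dyadic_index m (c l) a.
      by apply: le_floor; rewrite ler_pM2r ?invr_gt0//; lra.
    have hi : dyadic_index m (c l) a < f a + 1 + 1.
      rewrite /dyadic_index floor_lt_int intrD.
      have /andP[_ g2] := floor_itv ((x ord0 a - 2 * r) / 2 ^ m).
      have : c l ord0 a / 2 ^ m < (x ord0 a - 2 * r) / 2 ^ m + 1.
        by rewrite ltr_pdivrMr// mulrDl mul1r divfK ?gt_eqF//; lra.
      by rewrite -/(f a) in g2; lra.
    have [->|ne] := eqVneq (dyadic_index m (c l) a) (f a); [by left|right].
    apply/eqP; rewrite eq_le -ltzD1 hi/= lezD1 lt_neqAle lo andbT.
    by rewrite eq_sym.
  have ne1 : (f a + 1 == f a) = false by rewrite -subr_eq0 addrAC subrr add0r.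
  have := congr1 (fun g : {ffun 'I_n.+1 -> bool} => g a) ij; rewrite !ffunE.
  by case: (cases i acti) => ->; case: (cases j actj) => ->; rewrite ?eqxx ?ne1.
have mass := density_mass x r r0 dens.
pose t p j : \bar R := if active x r j && (pat j == p) then (rho j `^ delta)%:E else 0%E.
have t0 p j : (0 <= t p j)%E by rewrite /t; case: ifP => // _; rewrite lee_fin powR_ge0.
have split_pat j : ((if active x r j then (rho j `^ delta)%:E else 0) =
    \sum_(p : {ffun 'I_n.+1 -> bool}) t p j)%E.
  rewrite (bigD1 (pat j))//= big1 ?adde0; first by rewrite /t eqxx andbT.
  by move=> p pj; rewrite /t eq_sym (negbTE pj) andbF.
pose L := nu `^ (delta / n.+1%:R) * r `^ delta.
have L0 : 0 < L by rewrite mulr_gt0// powR_gt0.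
have [p hp] : exists p, ((L / 2 ^+ n.+1)%:E < \sum_(0 <= j <oo) t p j)%E.
  apply: contrapT => /forallNP none; move: mass; rewrite ltNge => /negP; apply.
  under eq_eseriesr do rewrite split_pat.
  rewrite nneseries_sum//.
  apply: (@le_trans _ _ (\sum_(p : {ffun 'I_n.+1 -> bool}) (L / 2 ^+ n.+1)%:E)%E).
    by apply: lee_sum => p _; rewrite leNgt; apply/negP; exact: none.
  rewrite sumEFin lee_fin sumr_const card_ffun card_bool card_ord -[leLHS]mulr_natr.
  by rewrite natrX divfK// expf_neq0.
have [j actj patj] : exists2 j, active x r j & pat j = p.
  apply: contrapT => none; move: hp; rewrite eseries0.
    by rewrite lte_fin ltNge divr_ge0 ?ltW// exprn_ge0.
  move=> j _ _; rewrite /t; case: ifP => // /andP[actj /eqP patj].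
  by exfalso; apply: none; exists j.
exists j, m; split.
- rewrite /heavy.
  apply: (@le_trans _ _ (K%:E * \sum_(0 <= i <oo) t p i)%E); last first.
    apply: lee_wpmul2l; first by rewrite lee_fin ltW.
    apply: lee_nneseries => [i _ _|i _]; first exact: t0.
    rewrite /t; case: ifP => [/andP[acti /eqP pati]|_].
      by rewrite ifT//; apply/asboolP; apply: pat_same => //; rewrite pati.
    by case: ifP => // _; rewrite lee_fin powR_ge0.
  apply: (@le_trans _ _ (K%:E * (L / 2 ^+ n.+1)%:E)%E); last first.
    by apply: lee_wpmul2l; [rewrite lee_fin ltW|exact: ltW].
  rewrite -EFinM lee_fin KE /L.
  rewrite (_ : _ / _ * (_ / _) = 8 `^ delta * r `^ delta); last first.
    have : 2 ^+ n.+1 != 0 :> R by rewrite expf_neq0.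
    have : nu `^ (delta / n.+1%:R) != 0 by rewrite gt_eqF.
    move: (2 ^+ n.+1 : R) (nu `^ _) (8 `^ _) (r `^ _) => a1 a2 a3 a4 h1 h2; field.
    by rewrite h1 h2.
  rewrite -powRM ?(ltW r0)//; apply: ge0_ler_powR; rewrite ?nnegrE ?(ltW delta0) ?(ltW m0)//.
    by rewrite mulr_ge0// ltW.
  rewrite mE; lra.
- rewrite -/m in k2; lra.
- apply: (lt_le_trans (near j actj)); rewrite -/m in k2; lra.
Qed.

End density_heavy.

(** * Hausdorff content and Choquet integrals *)

Section hausdorff_content.
Context {R : realType} {n : nat} (beta : R).
Local Notation V := 'rV[R]_n.
Local Notation radius_ge0 := (fun cr : V * R => 0 <= cr.2).
Local Notation ball_of := (fun cr : V * R => eball cr.1 cr.2).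
Local Notation weight := (fun cr : V * R => (cr.2 `^ beta)%:E).
Hypothesis beta0 : 0 < beta.

Lemma hcontentE : @hcontent R n beta = cover_inf radius_ge0 ball_of weight.
Proof.
apply/funext => E; congr ereal_inf; apply/seteqP; split=> s /=.
  by move=> [c [r [r0 [Ecov ->]]]]; exists (fun k => (c k, r k)).
move=> [k [Pk Ek ->]]; by exists (fun j => (k j).1), (fun j => (k j).2).
Qed.

Let weight_ge0 (cr : V * R) : 0 <= cr.2 -> (0 <= (cr.2 `^ beta)%:E)%E.
Proof. by move=> _; rewrite lee_fin powR_ge0. Qed.

Lemma hcontent_ge0 (E : set V) : (0 <= hcontent beta E)%E.
Proof. by rewrite hcontentE; exact: cover_inf_ge0. Qed.

Lemma le_hcontent (E F : set V) : E `<=` F -> (hcontent beta E <= hcontent beta F)%E.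
Proof. by rewrite hcontentE; exact: le_cover_inf. Qed.

Lemma hcontent_series (E : set V) (c : nat -> V) (r : nat -> R) : (forall j, 0 <= r j) ->
  E `<=` \bigcup_j eball (c j) (r j) -> (hcontent beta E <= \sum_(0 <= j <oo) (r j `^ beta)%:E)%E.
Proof.
move=> r0 Ecov; rewrite hcontentE.
exact: (@cover_inf_le _ _ _ radius_ge0 ball_of weight (fun j => (c j, r j))).
Qed.

(** Monotonicity of the content is enough: the superlevel sets of a nonincreasing function are
    intervals. *)
Lemma hcontent_nonincreasing_measurable (h : R -> set V) (D : set R) : measurable D ->
  (forall s t, s <= t -> h t `<=` h s) -> measurable_fun D (fun t => hcontent beta (h t)).
Proof.
move=> mD dech; apply: measurable_funTS.
apply: (measurability _ (ErealGenOInfty.measurableE R)) => _ [_ [y ->] <-].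
rewrite setTI; apply: is_interval_measurable => s t /= hs ht z /andP[_ zt].
move: ht; rewrite !in_itv/= !andbT => /lt_le_trans; apply.
by apply: le_hcontent; exact: dech.
Qed.


Lemma choquet_level_measurable (O : set V) (f : V -> R) :
  measurable_fun (`[0, +oo[%classic : set R) (fun t => hcontent beta [set x | O x /\ t < f x]).
Proof.
apply: hcontent_nonincreasing_measurable => // s t st x [Ox tf]; split=> //.
exact: le_lt_trans tf.
Qed.

(** The ball [j] serves only in the coverings at heights [t < alpha j], so integrating its cost over
    [t] produces the factor [alpha j]. *)
Lemma choquet_le_series (O : set V) (f : V -> R) (c : nat -> V) (r alpha : nat -> R) :
  (forall j, 0 <= r j) -> (forall j, 0 <= alpha j) ->
  (forall x t, O x -> 0 <= t -> t < f x -> exists j, eball (c j) (r j) x /\ t < alpha j) ->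
  (choquet beta O f <= \sum_(0 <= j <oo) (alpha j * r j `^ beta)%:E)%E.
Proof.
move=> r0 alpha0 cov; rewrite /choquet.
pose D := `[0, +oo[%classic : set R.
have mD : measurable D by exact: measurable_itv.
pose I j := `]-oo, alpha j[%classic : set R.
have mI j : measurable_fun D (fun t => (\1_(I j) t)%:E : \bar R).
  by apply/measurable_EFinP; apply: measurable_indic; exact: measurable_itv.
have mrI j : measurable_fun D (fun t => ((r j `^ beta)%:E * (\1_(I j) t)%:E)%E : \bar R).
  exact: measurable_funeM.
have rI0 j t : (0 <= (r j `^ beta)%:E * (\1_(I j) t)%:E)%E.
  by rewrite mule_ge0// lee_fin powR_ge0.
apply: (@le_trans _ _ (\int[@lebesgue_measure R]_(t in D)
    \sum_(0 <= j <oo) ((r j `^ beta)%:E * (\1_(I j) t)%:E))%E).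
  apply: ge0_le_integral => //.
  - by move=> t _; exact: hcontent_ge0.
  - exact: choquet_level_measurable.
  - by apply: ge0_emeasurable_sum => [j t _ _|j _]; [exact: rI0|exact: mrI].
  - move=> t; rewrite /D/= in_itv/= andbT => t0.
    (* Balls that do not serve at height [t] get radius 0: they are empty, and they cost nothing
       because [0 < beta]. *)
    pose rt j := if t < alpha j then r j else 0.
    apply: (@le_trans _ _ (\sum_(0 <= j <oo) (rt j `^ beta)%:E)%E).
      apply: (@hcontent_series _ c rt); first by move=> j; rewrite /rt; case: ifP.
      move=> x [Ox tf]; have [j [xj tj]] := cov x t Ox t0 tf.
      by exists j => //; rewrite /rt tj.
    apply: lee_nneseries => [j _ _|j _]; first by rewrite lee_fin powR_ge0.
    rewrite /rt indicE; case: ifPn => tj.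
      by rewrite mem_set ?mule1//= in_itv.
    by rewrite powR0 ?gt_eqF// mule_ge0 ?lee_fin ?powR_ge0.
rewrite (@integral_nneseries _ _ _ (@lebesgue_measure R) D mD
  (fun j t => ((r j `^ beta)%:E * (\1_(I j) t)%:E)%E)); last 2 first.
- exact: mrI.
- by move=> j t _; exact: rI0.
apply: lee_nneseries => [j _ _|j _]; first by apply: integral_ge0 => t _; exact: rI0.
rewrite (@ge0_integralZl _ _ _ (@lebesgue_measure R) D mD (fun t => (\1_(I j) t)%:E)%E); last 3 first.
- exact: mI.
- by move=> t _; rewrite lee_fin.
- by rewrite lee_fin powR_ge0.
rewrite mulrC EFinM; apply: lee_wpmul2l; first by rewrite lee_fin powR_ge0.
rewrite integral_indic//; last exact: measurable_itv.
have muA : (@lebesgue_measure R `[0%R, alpha j[%classic <= (alpha j)%:E)%E.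
  rewrite lebesgue_measure_itv/= lte_fin; case: ifPn => _; last by rewrite lee_fin.
  by rewrite -EFinB subr0.
rewrite (_ : I j `&` D = `[0, alpha j[%classic); first exact: muA.
apply/seteqP; split=> t; rewrite /I /D/= !in_itv/= ?andbT.
  by move=> [-> ->].
by move=> /andP[-> ->].
Qed.

(** The intervals from 2^((k - 1) p) to 2^(k p) are disjoint and have length (1 - 2^-p) 2^(k p). For
    [t] in such an interval, the set where g^p > t contains the set where g > 2^k. *)
Lemma choquet_ge_series (p : R) (O : set V) (g : V -> R) (kz : nat -> int) :
  0 < p -> (forall x, 0 <= g x) -> injective kz ->
  ((1 - 2 `^ (- p))%:E * \sum_(0 <= i <oo) (((2 ^ kz i) `^ p)%:E *
     hcontent beta [set x | O x /\ (2 ^ kz i < g x)%R])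
   <= choquet beta O (fun x => g x `^ p)%R)%E.
Proof.
move=> p0 g0 kzI; rewrite /choquet.
pose D := `[0, +oo[%classic : set R.
have mD : measurable D by exact: measurable_itv.
pose b i := (2 ^ kz i) `^ p : R.
pose a i := (2 ^ (kz i - 1)) `^ p : R.
have abE i : b i - a i = (1 - 2 `^ (- p)) * b i.
  rewrite /b /a expfzDr// powRM ?exprz_ge0// -[2 ^ (-1)]powR_intmul// -powRrM.
  by rewrite (_ : (-1)%:~R * p = - p :> R) ?mulN1r//; ring.
have q1 : 2 `^ (- p) < 1 :> R.
  by rewrite -[ltRHS](powRr0 2); apply: gt1_ltr_powR; rewrite ?ltr1n// oppr_lt0.
have b0 i : 0 < b i by rewrite powR_gt0// exprz_gt0.
have a0 i : 0 <= a i by rewrite powR_ge0.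
have ab i : a i < b i.
  by rewrite -subr_gt0 abE mulr_gt0// subr_gt0.
pose I i := `[a i, b i[%classic : set R.
pose H i := hcontent beta [set x | O x /\ 2 ^ kz i < g x].
have H0 i : (0 <= H i)%E by exact: hcontent_ge0.
have mI i : measurable_fun D (fun t => (\1_(I i) t)%:E : \bar R).
  by apply/measurable_EFinP; apply: measurable_indic; exact: measurable_itv.
have mHI i : measurable_fun D (fun t => (H i * (\1_(I i) t)%:E)%E : \bar R).
  exact: measurable_funeM.
have HI0 i t : (0 <= H i * (\1_(I i) t)%:E)%E by rewrite mule_ge0// lee_fin.
have -> : ((1 - 2 `^ (- p))%:E * \sum_(0 <= i <oo) ((b i)%:E * H i) =
   \int[@lebesgue_measure R]_(t in D) \sum_(0 <= i <oo) (H i * (\1_(I i) t)%:E))%E.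
  rewrite (@integral_nneseries _ _ _ (@lebesgue_measure R) D mD
    (fun i t => (H i * (\1_(I i) t)%:E)%E)); last 2 first.
  - exact: mHI.
  - by move=> i t _; exact: HI0.
  rewrite -nneseriesZl; last by move=> i _; rewrite mule_ge0// lee_fin ltW.
  apply: eq_eseriesr => i _.
  rewrite (@ge0_integralZl _ _ _ (@lebesgue_measure R) D mD (fun t => (\1_(I i) t)%:E)%E); last 3 first.
  - exact: mI.
  - by move=> t _; rewrite lee_fin.
  - exact: H0.
  rewrite muleA -EFinM -abE muleC; congr (_ * _)%E.
  rewrite integral_indic//; last exact: measurable_itv.
  have muI : @lebesgue_measure R (I i) = (b i - a i)%:E.
    by rewrite /I lebesgue_measure_itv/= lte_fin ab.
  rewrite (_ : I i `&` D = I i); first exact/esym/muI.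
  apply/seteqP; split=> t; rewrite /I /D/= !in_itv/= ?andbT; first by case.
  by move=> /andP[h1 h2]; rewrite h1 h2; split=> //; exact: le_trans h1.
apply: ge0_le_integral => //.
- by move=> t _; apply: nneseries_ge0 => i _ _; exact: HI0.
- by apply: ge0_emeasurable_sum => [i t _ _|i _]; [exact: HI0|exact: mHI].
- exact: choquet_level_measurable.
move=> t _; have [[i]|none] := pselect (exists i, I i t); last first.
  rewrite eseries0; first exact: hcontent_ge0.
  move=> i _ _; rewrite indicE memNset ?mule0// => Ii; apply: none; by exists i.
rewrite /I/= in_itv/= => /andP[ait tbi].
rewrite (@nneseriesD1 _ (fun i => (H i * (\1_(I i) t)%:E)%E) i)// eseries0 ?adde0.
  rewrite indicE mem_set; last by rewrite /I/= in_itv/= ait.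
  rewrite mule1; apply: le_hcontent => x [Ox gx]; split=> //.
  apply: (lt_trans tbi); apply: gt0_ltr_powR => //; rewrite ?nnegrE ?exprz_ge0//.
move=> j _ ji; rewrite indicE memNset ?mule0// /I/= in_itv/= => /andP[ajt tbj].
have lekz i1 i2 : a i1 < b i2 -> kz i1 <= kz i2.
  move=> lt12; rewrite leNgt; apply/negP => lt21.
  have : b i2 <= a i1.
    apply: ge0_ler_powR; rewrite ?nnegrE ?exprz_ge0 ?(ltW p0)// ler_eXz2l ?ltr1n//.
    by rewrite lerBrDr lezD1.
  by rewrite leNgt lt12.
move: ji; rewrite (kzI j i) ?eqxx//; apply/eqP; rewrite eq_le !lekz//.
- exact: le_lt_trans tbj.
- exact: le_lt_trans tbi.
Qed.

End hausdorff_content.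

Lemma nat_int_enum : exists kz : nat -> int, injective kz /\ forall k, exists i, kz i = k.
Proof.
exists (fun i => if odd i then Negz i./2 else Posz i./2); split=> [i j|[k|k]].
- case: ifP => oi; case: ifP => oj // [] ij.
    by rewrite -(odd_double_half i) -(odd_double_half j) oi oj ij.
  by rewrite -(odd_double_half i) -(odd_double_half j) oi oj ij.
- by exists k.*2; rewrite odd_double doubleK.
- by exists k.*2.+1; rewrite /= odd_double/= uphalf_double.
Qed.

Lemma enorm_le {R : realType} {n : nat} (x : 'rV[R]_n) : enorm x <= n%:R * `|x|.
Proof.
rewrite -[leRHS]ger0_norm ?mulr_ge0// -sqrtr_sqr; apply: ler_wsqrtr.
apply: (@le_trans _ _ (\sum_(i < n) `|x| ^+ 2)).
  apply: ler_sum => i _; rewrite -[leLHS]ger0_norm ?sqr_ge0// normrX ler_pXn2r ?nnegrE//.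
  rewrite [leRHS]/Num.norm/= mx_normrE.
  by apply/bigmax_geP; right => /=; exists (ord0, i).
rewrite sumr_const card_ord exprMn -[leLHS]mulr_natl ler_wpM2r ?sqr_ge0//.
by rewrite -natrX ler_nat; case: n x => // m x; rewrite -{1}(expn1 m.+1) leq_pexp2l.
Qed.

Lemma dist_bdry_ge0 {R : realType} {n : nat} (O : set 'rV[R]_n) x : 0 <= dist_bdry O x.
Proof.
rewrite /dist_bdry; set S := (X in inf X).
have [->|/set0P S0] := eqVneq S set0; first by rewrite inf0.
by apply: lb_le_inf => // _ [y _ <-]; exact: sqrtr_ge0.
Qed.

(** * The Hardy inequality *)

Lemma nat_triple_enum : exists f : nat -> nat * (nat * nat),
  (forall t, exists k, f k = t) /\
  forall (R : realType) (a : nat * (nat * nat) -> \bar R), (forall t, (0 <= a t)%E) ->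
    (\sum_(0 <= k <oo) a (f k) =
     \sum_(0 <= i <oo) \sum_(0 <= l <oo) \sum_(0 <= j <oo) a (i, (l, j)))%E.
Proof.
have [f [fS fE]] := nat_pair_enum.
exists (fun k => ((f k).1, f (f k).2)); split=> [[i t]|R a a0].
  by have [q fq] := fS t; have [k fk] := fS (i, q); exists k; rewrite fk/= fq.
rewrite [LHS](fE R (fun iq => a (iq.1, f iq.2)))//; apply: eq_eseriesr => i _ /=.
exact: (fE R (fun t => a (i, t))).
Qed.

(** * Near-optimal coverings of all dyadic level sets *)

Section level_covers.
Context {R : realType} {n : nat}.
Local Notation V := 'rV[R]_n.

(** A finite Choquet integral makes the content of each level set finite, by [choquet_ge_series].
    The error [tiny k] allowed at level [k] is divided by the weight 2^(k p), so that the weighted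
    errors add up to at most [eps]. *)
Lemma level_covers (delta p eps : R) (O : set V) (g : V -> R) (kz : nat -> int) :
  0 < delta -> 0 < p -> 0 < eps -> (forall x, 0 <= g x) ->
  injective kz -> (forall k, exists i, kz i = k) ->
  (choquet delta O (fun x => g x `^ p)%R < +oo)%E ->
  exists (c : int -> nat -> V) (rho : int -> nat -> R), [/\
    forall k j, 0 <= rho k j,
    forall k x, O x -> 2 ^ k < g x -> exists j, eball (c k j) (rho k j) x,
    forall k, (\sum_(0 <= j <oo) (rho k j `^ delta)%:E < +oo)%E &
    (\sum_(0 <= i <oo) (((2 ^ kz i) `^ p)%:E * \sum_(0 <= j <oo) (rho (kz i) j `^ delta)%:E)
      <= ((1 - 2 `^ (- p))^-1)%:E * choquet delta O (fun x => g x `^ p)%R + eps%:E)%E].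
Proof.
move=> delta0 p0 eps0 g0 kzI kzS; set Q := choquet _ _ _ => Qoo.
have lower := choquet_ge_series delta p O g kz p0 g0 kzI.
rewrite -/Q in lower.
have q1 : 0 < 1 - 2 `^ (- p) :> R.
  by rewrite subr_gt0 -[ltRHS](powRr0 2); apply: gt1_ltr_powR; rewrite ?ltr1n// oppr_lt0.
pose H k := hcontent delta [set x | O x /\ 2 ^ k < g x].
have H0 k : (0 <= H k)%E by exact: hcontent_ge0.
have b0 k : 0 < (2 ^ k) `^ p :> R by rewrite powR_gt0// exprz_gt0.
have bH0 i : (0 <= ((2 ^ kz i) `^ p)%:E * H (kz i))%E by rewrite mule_ge0// lee_fin ltW.
have sum_le : (\sum_(0 <= i <oo) (((2 ^ kz i) `^ p)%:E * H (kz i)) <=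
    ((1 - 2 `^ (- p))^-1)%:E * Q)%E.
  rewrite -lee_pdivrMl ?invr_gt0// invrK; exact: lower.
have Hoo k : (H k < +oo)%E.
  have [i <-] := kzS k.
  have : (((2 ^ kz i) `^ p)%:E * H (kz i) < +oo)%E.
    apply: le_lt_trans (_ : _ <= ((1 - 2 `^ (- p))^-1)%:E * Q)%E _.
      apply: le_trans sum_le.
      rewrite (@nneseriesD1 _ (fun i => (((2 ^ kz i) `^ p)%:E * H (kz i))%E) i)// leeDl//.
      by apply: nneseries_ge0 => j _ _; exact: bH0.
    by rewrite lte_mul_pinfty// lee_fin invr_ge0 ltW.
  have := H0 (kz i); case: (H (kz i)) => [h|_|//]; first by move=> _ _; rewrite ltry.
  by rewrite gt0_muley ?lte_fin// ltxx.
have /choice[idx idxK] := kzS.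
have idx_kz i : idx (kz i) = i by apply: kzI; rewrite idxK.
pose tiny k := eps / (2 ^ (idx k).+1)%:R / (2 ^ k) `^ p.
have tiny0 k : 0 < tiny k by rewrite !divr_gt0// ltr0n expn_gt0.
have /choice[cr Pcr] : forall k, exists cr : nat -> V * R, [/\ forall j, 0 <= (cr j).2,
    [set x | O x /\ 2 ^ k < g x] `<=` \bigcup_j eball (cr j).1 (cr j).2 &
    (\sum_(0 <= j <oo) ((cr j).2 `^ delta)%:E <= H k + (tiny k)%:E)%E].
  move=> k; have := Hoo k; rewrite /H hcontentE => Hk.
  apply: (cover_inf_near (fun cr : V * R => 0 <= cr.2) (fun cr => eball cr.1 cr.2)
    (fun cr => (cr.2 `^ delta)%:E) _ _ (tiny k) (tiny0 k) Hk).
  by move=> i _; rewrite lee_fin powR_ge0.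
exists (fun k j => (cr k j).1), (fun k j => (cr k j).2); split.
- by move=> k j; have [h _ _] := Pcr k; exact: h.
- move=> k x Ox gx; have [_ h _] := Pcr k; have [j _ xj] := h x (conj Ox gx).
  by exists j.
- move=> k; have [_ _ h] := Pcr k; apply: (le_lt_trans h).
  by rewrite lte_add_pinfty// ltry.
- apply: (@le_trans _ _ (\sum_(0 <= i <oo) (((2 ^ kz i) `^ p)%:E * H (kz i) +
      (eps / (2 ^ i.+1)%:R)%:E))%E).
    apply: lee_nneseries => [i _ _|i _].
      rewrite mule_ge0 ?lee_fin ?(ltW (b0 _))//; apply: nneseries_ge0 => j _ _.
      by rewrite lee_fin powR_ge0.
    have [_ _ h] := Pcr (kz i).
    apply: (le_trans (lee_wpmul2l _ h)); first by rewrite lee_fin ltW.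
    rewrite ge0_muleDr//; last by rewrite lee_fin ltW.
    by rewrite -EFinM /tiny idx_kz mulrC divfK// gt_eqF.
  apply: (le_trans (epsilon_trick _ _ (ltW eps0))) => //.
  by apply: leeD.
Qed.

End level_covers.

(** * Choquet integral estimate from the heavy cubes *)

Section content_estimate.
Context {R : realType} {n : nat} (delta kappa p s C0 : R).
Local Notation V := 'rV[R]_n.+1.
Local Notation beta := (delta - kappa * p).
Local Notation e := (s * delta / n.+1%:R).
Hypothesis delta0 : 0 < delta.
Hypothesis deltan : delta <= n.+1%:R.
Hypothesis kappa0 : 0 <= kappa.
Hypothesis p0 : 0 < p.
Hypothesis beta0 : 0 < beta.
Hypothesis s0 : 0 < s.
Hypothesis ep : e < p.
Hypothesis C00 : 0 < C0.

(** The power of [C0] comes from the heights, that of [3 * n.+1] from the ratio of radius to side,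
    and the last factor is the sum over [l] of the series in [K_geometric]. *)
Definition content_const : R :=
  C0 `^ p * (3 * n.+1%:R) `^ beta * (8 `^ delta * 2 ^+ n.+1 * 2 `^ e / (1 - 2 `^ (e - p))).

Let theta1 : 0 < 1 - 2 `^ (e - p) :> R.
Proof.
by rewrite subr_gt0 -[ltRHS](powRr0 2); apply: gt1_ltr_powR; rewrite ?ltr1n ?subr_lt0.
Qed.

Lemma content_const_gt0 : 0 < content_const.
Proof.
by rewrite /content_const !mulr_gt0 ?powR_gt0 ?exprn_gt0 ?invr_gt0.
Qed.

(** Density threshold for a ratio T / (2^k r^kappa) between 2^-(l+1) and 2^-l: the lower end raised
    to the power [s]. *)
Let nu (l : nat) : R := (2 `^ (- s)) ^+ l.+1.
Let A : R := 8 `^ delta * 2 ^+ n.+1.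
Let K l : R := A / nu l `^ (delta / n.+1%:R).

Let nu0 l : 0 < nu l. Proof. by rewrite exprn_gt0// powR_gt0. Qed.

Let nu1 l : nu l <= 1.
Proof.
rewrite exprn_ile1 ?powR_ge0// -[leRHS](powRr0 2); apply: ler_powR; rewrite ?ler1n// oppr_le0.
exact: ltW.
Qed.

Let A0 : 0 < A. Proof. by rewrite mulr_gt0 ?powR_gt0 ?exprn_gt0. Qed.

Let K0 l : 0 < K l. Proof. by rewrite divr_gt0// powR_gt0. Qed.

(** Lowering the density threshold makes [K l] grow like 2^(e l), while the heights decay like 2^(-p
    l); [e < p] makes the product summable. *)
Let K_geometric l : (2^-1 ^+ l) `^ p * K l = A * 2 `^ e * (2 `^ (e - p)) ^+ l.
Proof.
have two0 x : (x == 0 :> R) ==> (2 != 0 :> R) by rewrite pnatr_eq0 implybT.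
rewrite /K.
have -> : nu l `^ (delta / n.+1%:R) = 2 `^ (- (e * l.+1%:R)).
  by rewrite /nu -powR_mulrn ?powR_ge0// -!powRrM; congr (_ `^ _); ring.
have -> : (2^-1 ^+ l) `^ p = 2 `^ (- (p * l%:R)) :> R.
  by rewrite exprVn -powR_invn// -powRrM; congr (_ `^ _); ring.
rewrite -powRN opprK mulrCA -powRD// -(powR_mulrn l (powR_ge0 2 (e - p))) -powRrM.
by rewrite -[RHS]mulrA -powRD//; congr (_ * _ `^ _); rewrite -natr1; ring.
Qed.

(** A point with too high a density at level [k] and radius [r] is close to a selected cube of side
    at least [r], so T <= 2^k 2^-l side^kappa, which dictates the height [alpha]. Since kappa p +
    beta = delta, height times radius^beta is a multiple of 2^(k p) 2^(-l p) side^delta, and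
    [heavy_selection] sums the powers of the sides. *)
Lemma content_estimate (O : set V) (f : V -> R) (c : int -> nat -> V) (rho : int -> nat -> R)
    (kz : nat -> int) :
  (forall k j, 0 <= rho k j) ->
  (forall k, (\sum_(0 <= j <oo) (rho k j `^ delta)%:E < +oo)%E) ->
  (forall k, exists i, kz i = k) ->
  (forall x t, O x -> 0 <= t -> t < f x -> exists (T : R) (k : int) (r : R),
    [/\ 0 < T, t < (C0 * T) `^ p, 0 < r, T < 2 ^ k * r `^ kappa &
      (((T / (2 ^ k * r `^ kappa)) `^ s)%:E < ball_density (c k) (rho k) x r)%E]) ->
  (choquet beta O f <= content_const%:E *
    \sum_(0 <= i <oo) (((2 ^ kz i) `^ p)%:E * \sum_(0 <= j <oo) (rho (kz i) j `^ delta)%:E))%E.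
Proof.
move=> rho0 rho_fin kzS fP.
have /choice[JM PJM] : forall il : nat * nat, exists JM : (nat -> Prop) * (nat -> int),
  (\sum_(0 <= j <oo) (if `[< JM.1 j >] then ((2 ^ JM.2 j) `^ delta)%:E else 0)
     <= (K il.2)%:E * \sum_(0 <= j <oo) (rho (kz il.1) j `^ delta)%:E)%E /\
  forall j m, heavy (c (kz il.1)) (rho (kz il.1)) delta (K il.2) (c (kz il.1) j) m ->
    exists j', [/\ JM.1 j', m <= JM.2 j' & same_cube (JM.2 j') (c (kz il.1) j) (c (kz il.1) j')].
  move=> [i l]; have [J [M JMP]] := heavy_selection (c (kz i)) (rho (kz i)) delta (K l) delta0 (K0 l) (rho_fin (kz i)).
  by exists (J, M).
pose J i l j := `[< (JM (i, l)).1 j >]; pose M i l j := (JM (i, l)).2 j.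
have [g [gS gE]] := nat_triple_enum.
(* In the maximum norm [x] is at most two sides away from a centre in the selected cube, and that
   centre at most one side away from the label; the factor [n.+1] passes to the Euclidean norm. *)
pose rad t := if J t.1 t.2.1 t.2.2 then 3 * n.+1%:R * 2 ^ M t.1 t.2.1 t.2.2 else 0 : R.
pose alpha t := if J t.1 t.2.1 t.2.2 then
  (C0 * (2 ^ kz t.1 * (2^-1 ^+ t.2.1 * (2 ^ M t.1 t.2.1 t.2.2) `^ kappa))) `^ p else 0 : R.
have rad0 t : 0 <= rad t.
  by rewrite /rad; case: ifP => // _; rewrite !mulr_ge0// exprz_ge0.
have alpha0 t : 0 <= alpha t by rewrite /alpha; case: ifP => // _; exact: powR_ge0.
have cover x t : O x -> 0 <= t -> t < f x -> exists N,
    eball (c (kz (g N).1) (g N).2.2) (rad (g N)) x /\ t < alpha (g N).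
  move=> Ox t0 tf; have [T [k [r [T0 tT r0 Tk dens]]]] := fP x t Ox t0 tf.
  have [i ik] := kzS k; rewrite -ik in Tk dens.
  pose y := T / (2 ^ kz i * r `^ kappa).
  have D0 : 0 < 2 ^ kz i * r `^ kappa by exact: lt_trans Tk.
  have y0 : 0 < y by rewrite divr_gt0.
  have y1 : y < 1 by rewrite ltr_pdivrMr// mul1r.
  have [k' /andP[k'1 k'2]] : exists k' : int, 2 ^ k' <= y^-1 < 2 ^ (k' + 1).
    by apply: dyadic_level; rewrite invr_gt0.
  (* As [y < 1], the dyadic level of [y^-1] is a natural number [l]. *)
  have k'0 : 0 <= k'.
    rewrite -ltzD1 -(@ltr_eXz2l R 2) ?ltr1n// expr0z; apply: lt_trans k'2.
    by rewrite invf_gt1.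
  case: k' k'1 k'2 k'0 => [l|//] k'1 k'2 _.
  have yl : y <= 2^-1 ^+ l.
    by rewrite -[y]invrK exprVn lef_pV2 ?posrE ?invr_gt0 ?exprn_gt0.
  have nuy : nu l <= y `^ s.
    have -> : nu l = (2 ^- l.+1) `^ s.
      rewrite /nu -powR_mulrn; last exact: powR_ge0.
      rewrite -powR_invn; last exact: ler0n.
      by rewrite -!powRrM; congr (_ `^ _); ring.
    apply: ge0_ler_powR; rewrite ?nnegrE ?(ltW s0) ?(ltW y0) ?invr_ge0 ?exprn_ge0//.
    rewrite -[y]invrK lef_pV2 ?posrE ?invr_gt0 ?exprn_gt0//.
    by move: k'2; rewrite -PoszD addn1 => /ltW.
  have densl : ((nu l)%:E < ball_density (c (kz i)) (rho (kz i)) x r)%E.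
    by apply: le_lt_trans dens; rewrite lee_fin.
  have [j [m [hm rm xj]]] := density_heavy (c (kz i)) (rho (kz i)) delta (nu l) (K l)
    delta0 deltan (rho0 (kz i)) (nu0 l) (nu1 l) erefl x r r0 densl.
  have [_ sel] := PJM (i, l); have [j' [Jj' mM sj']] := sel j m hm.
  have [N gN] := gS (i, (l, j')); exists N; rewrite gN /=.
  have Jt : J i l j' by apply/asboolP.
  have m2 : 2 ^ m <= 2 ^ M i l j' :> R by rewrite ler_eXz2l ?ltr1n.
  have M0 : 0 < 2 ^ M i l j' :> R by rewrite exprz_gt0.
  rewrite /rad /alpha /= Jt; split.
    rewrite /eball/=; apply: (le_lt_trans (enorm_le _)).
    rewrite [3 * _]mulrC -mulrA ltr_pM2l ?ltr0n//.
    rewrite -(subrKA (c (kz i) j)); apply: (le_lt_trans (ler_normD _ _)).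
    have := same_cube_dist _ _ _ sj'; rewrite -/(M i l j'); lra.
  apply: (lt_le_trans tT); apply: ge0_ler_powR; rewrite ?nnegrE ?(ltW p0)//.
  - by rewrite mulr_ge0 ?ltW.
  - by rewrite !mulr_ge0 ?(ltW C00) ?exprz_ge0 ?exprn_ge0 ?invr_ge0 ?powR_ge0.
  rewrite ler_pM2l//.
  have -> : T = 2 ^ kz i * (y * r `^ kappa).
    by rewrite mulrCA /y divfK ?gt_eqF.
  rewrite ler_pM2l ?exprz_gt0//; apply: ler_pM; rewrite ?powR_ge0 ?(ltW y0)//.
  apply: ge0_ler_powR; rewrite ?nnegrE ?(ltW r0) ?(ltW M0)//.
  exact: le_trans m2.
apply: (le_trans (choquet_le_series beta beta0 O f (fun N => c (kz (g N).1) (g N).2.2)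
   (fun N => rad (g N)) (fun N => alpha (g N)) (fun N => rad0 (g N)) (fun N => alpha0 (g N)) cover)).
pose w t : \bar R := (alpha t * rad t `^ beta)%:E.
have w0 t : (0 <= w t)%E by rewrite lee_fin mulr_ge0// powR_ge0.
rewrite (gE R w w0) -nneseriesZl; last first.
  move=> i _; rewrite mule_ge0 ?lee_fin ?powR_ge0//.
  by apply: nneseries_ge0 => j _ _; rewrite lee_fin powR_ge0.
apply: lee_nneseries => [i _ _|i _].
  by apply: nneseries_ge0 => l _ _; apply: nneseries_ge0 => j _ _; exact: w0.
set S := (\sum_(0 <= j <oo) (rho (kz i) j `^ delta)%:E)%E.
have S0 : (0 <= S)%E by apply: nneseries_ge0 => j _ _; rewrite lee_fin powR_ge0.
pose Z : R := C0 `^ p * (3 * n.+1%:R) `^ beta * (2 ^ kz i) `^ p.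
have Z0 : 0 <= Z by rewrite !mulr_ge0 ?powR_ge0.
have wE l j : w (i, (l, j)) = ((Z * (2^-1 ^+ l) `^ p)%:E *
    (if J i l j then ((2 ^ M i l j) `^ delta)%:E else 0))%E.
  rewrite /w /alpha /rad /=; case: ifP => _; last by rewrite mul0r mule0.
  rewrite -EFinM; congr EFin.
  have M0 : 0 < 2 ^ M i l j :> R by rewrite exprz_gt0.
  have -> : (2 ^ M i l j) `^ delta = (2 ^ M i l j) `^ (kappa * p) * (2 ^ M i l j) `^ beta.
    by rewrite -powRD ?(gt_eqF M0) ?implybT//; congr (_ `^ _); ring.
  rewrite /Z !powRM ?mulr_ge0 ?powR_ge0 ?exprn_ge0 ?exprz_ge0 ?invr_ge0 ?(ltW C00) ?ler0n//.
  by rewrite -powRrM; ring.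
apply: (@le_trans _ _ (\sum_(0 <= l <oo) ((Z * A * 2 `^ e * (2 `^ (e - p)) ^+ l)%:E * S))%E).
  apply: lee_nneseries => [l _ _|l _]; first by apply: nneseries_ge0 => j _ _; exact: w0.
  under eq_eseriesr do rewrite wE.
  rewrite nneseriesZl; last by move=> j _; case: ifP => // _; rewrite lee_fin powR_ge0.
  have [sel _] := PJM (i, l).
  apply: (@le_trans _ _ ((Z * (2^-1 ^+ l) `^ p)%:E * ((K l)%:E * S))%E).
    by apply: lee_wpmul2l => //; rewrite lee_fin mulr_ge0// powR_ge0.
  rewrite muleA -EFinM.
  have -> : Z * (2^-1 ^+ l) `^ p * K l = Z * A * 2 `^ e * (2 `^ (e - p)) ^+ l; last by [].
  by rewrite -[LHS]mulrA K_geometric !mulrA.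
have fin0 l : 0 <= Z * A * 2 `^ e * (2 `^ (e - p)) ^+ l.
  by rewrite !mulr_ge0 ?(ltW A0) ?powR_ge0 ?exprn_ge0 ?powR_ge0.
have SE : S = (fine S)%:E by rewrite fineK// ge0_fin_numE//; exact: rho_fin.
rewrite SE; under eq_eseriesr do rewrite muleC.
rewrite nneseriesZl; last by move=> l _; rewrite lee_fin.
rewrite eseries_geometric; last by rewrite powR_ge0/= -subr_gt0.
rewrite -!EFinM lee_fin le_eqVlt; apply/orP; left; apply/eqP; rewrite /content_const /Z /A; ring.
Qed.

End content_estimate.

Lemma grad_norm_off_support {R : realType} {n : nat} (O : set 'rV[R]_n) (u : 'rV[R]_n -> R) w :
  closure [set x | u x != 0] `<=` O -> ~ O w -> grad_norm u w = 0.
Proof.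
move=> supO nOw; have [A [wA Az]] : exists A, nbhs w A /\ forall x, A x -> u x = 0.
  apply: contrapT => none; apply: nOw; apply: supO => A wA.
  apply: contrapT => nA; apply: none; exists A; split=> // x Ax.
  by apply/eqP; apply: contrapT => /negP ux; apply: nA; exists x.
have D0 i : 'D_(evec R i) u w = 0.
  rewrite (@near_eq_derive R _ _ u (cst 0) w) ?derive_cst//.
  by apply: filterS wA => x Ax; exact: Az.
rewrite /grad_norm big1 ?sqrtr0// => i _; by rewrite D0 expr0n.
Qed.

Lemma hardy_choquet (R : realType) (n : nat) (delta kappa p b : R) :
  0 < delta -> delta <= n.+1%:R -> 0 <= kappa -> kappa < 1 ->
  delta / n.+1%:R < p -> kappa * p < delta -> 0 < b ->
  exists c : R, 0 < c /\
    forall O : set 'rV[R]_n.+1, outer_regular O b ->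
    forall u : 'rV[R]_n.+1 -> R, C1_0 O u ->
      (choquet (delta - kappa * p) O
         (fun x => (`|u x| `^ p / dist_bdry O x `^ (p * (1 - kappa)))%R)
       <= c%:E * choquet delta O (fun x => (grad_norm u x `^ p)%R))%E.
Proof.
move=> delta0 deltan kappa0 kappa1 deltap kappap b0.
have N0 : 0 < n.+1%:R :> R by rewrite ltr0n.
have p0 : 0 < p by apply: lt_trans deltap; rewrite divr_gt0.
have beta0 : 0 < delta - kappa * p by rewrite subr_gt0.
have [s [s1 sp]] : exists s, 1 < s /\ s * delta / n.+1%:R < p.
  have dN0 : 0 < delta / n.+1%:R by rewrite divr_gt0.
  (* The midpoint of 1 and [p / (delta / n.+1)], the latter being larger than 1. *)
  exists ((1 + p / (delta / n.+1%:R)) / 2).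
  have h : 1 < p / (delta / n.+1%:R) by rewrite ltr_pdivlMr// mul1r.
  split; first by lra.
  rewrite -mulrA -ltr_pdivlMr//; lra.
have s0 : 0 < s by lra.
have [C0 C00 hardy] := @pointwise_hardy R n s kappa b s1 kappa0 kappa1 b0.
pose B := content_const (n := n) delta kappa p s C0.
have B0 : 0 < B by exact: content_const_gt0.
have q1 : 0 < 1 - 2 `^ (- p) :> R.
  by rewrite subr_gt0 -[ltRHS](powRr0 2); apply: gt1_ltr_powR; rewrite ?ltr1n// oppr_lt0.
exists (B / (1 - 2 `^ (- p))); split; first by rewrite divr_gt0.
move=> O regO u [du [cu [_ suppO]]].
set Q := choquet delta O _.
have [->|Qoo] := eqVneq Q +oo%E; first by rewrite gt0_muley ?leey// lte_fin divr_gt0.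
have Qlt : (Q < +oo)%E by rewrite ltey.
have [kz [kzI kzS]] := nat_int_enum.
apply/lee_addgt0Pr => eps eps0.
have [c [rho [rho0 cov rho_fin total]]] := level_covers delta p (eps / B) O (grad_norm u) kz
  delta0 p0 (divr_gt0 eps0 B0) (fun x => sqrtr_ge0 _) kzI kzS Qlt.
rewrite -/Q in total.
have uO w : ~ O w -> u w = 0.
  move=> nOw; apply/eqP; apply: contrapT => /negP uw; apply: nOw; apply: suppO.
  exact: subset_closure.
have cov' k w : 2 ^ k < grad_norm u w -> exists j, `|w - c k j| < rho k j.
  move=> kw; have Ow : O w.
    apply: contrapT => nOw; move: kw; rewrite (grad_norm_off_support O)//.
    by rewrite ltNge exprz_ge0.
  have [j wj] := cov k w Ow kw; exists j; apply: le_lt_trans wj; exact: normr_le_enorm.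
apply: (@le_trans _ _ (B%:E * (((1 - 2 `^ (- p))^-1)%:E * Q + (eps / B)%:E))%E); last first.
  rewrite ge0_muleDr ?lee_fin ?divr_ge0 ?(ltW eps0) ?(ltW B0)//; last first.
    rewrite mule_ge0 ?lee_fin ?invr_ge0 ?(ltW q1)//.
    by apply: integral_ge0 => t _; exact: hcontent_ge0.
  by rewrite muleA -!EFinM mulrCA mulfV ?gt_eqF// mulr1.
apply: le_trans (lee_wpmul2l _ total); last by rewrite lee_fin ltW.
apply: (content_estimate delta kappa p s C0 delta0 deltan kappa0 p0 beta0 s0 sp C00 O _ c rho kz) => //.
move=> x t Ox t0; set d := dist_bdry O x => tf.
(* At distance 0 the denominator is 0 and the quotient is 0 by convention, so no height [t >= 0]
   lies below it. *)
have d0 : 0 < d.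
  rewrite lt_neqAle dist_bdry_ge0 andbT eq_sym; apply/eqP => d0; move: tf; rewrite d0.
  by rewrite powR0 ?invr0 ?mulr0 ?ltNge ?t0// mulf_neq0 ?gt_eqF// subr_gt0.
pose G := `|u x| / d `^ (1 - kappa).
have dk0 : 0 < d `^ (1 - kappa) by rewrite powR_gt0.
have G0 : 0 <= G by rewrite divr_ge0// powR_ge0.
have GE : `|u x| `^ p / d `^ (p * (1 - kappa)) = G `^ p.
  rewrite /G powRM ?invr_ge0 ?powR_ge0// [p * _]mulrC powRrM; congr (_ * _).
  rewrite -powR_inv1; last exact: powR_ge0.
  by rewrite -[(d `^ (1 - kappa))^-1]powR_inv1 ?powR_ge0 1?powRAC.
rewrite GE in tf.
(* An intermediate height is positive even for [t = 0], so that [T] is positive, and it stays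
   strictly below G^p, so that [ub] is strict. *)
pose t' := (t + G `^ p) / 2.
have tt' : t < t' by rewrite /t'; lra.
have t'G : t' < G `^ p by rewrite /t'; lra.
have t'0 : 0 < t' by apply: le_lt_trans tt'.
pose T := t' `^ p^-1 / C0.
have T0 : 0 < T by rewrite divr_gt0// powR_gt0.
have CT : C0 * T = t' `^ p^-1 by rewrite mulrC divfK// gt_eqF.
have ub : C0 * T * d `^ (1 - kappa) < `|u x|.
  rewrite CT -ltr_pdivlMr// -/G.
  have -> : G = (G `^ p) `^ p^-1 by rewrite -powRrM mulfV ?gt_eqF// powRr1.
  by apply: gt0_ltr_powR; rewrite ?nnegrE ?invr_gt0 ?powR_ge0 ?(ltW t'0).
(* If the density were never too high, [pointwise_hardy] would contradict [ub]. *)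
exists T; apply: contrapT => none; move: ub; apply/negP; rewrite -leNgt.
apply: (hardy O u c rho) => // k r r0 Tk; rewrite leNgt; apply/negP => dens.
apply: none; exists k, r; split=> //.
by rewrite CT -powRrM mulVf ?gt_eqF// powRr1// ltW.
Qed.

Theorem theorem3p3 (R : realType) (n : nat) (delta kappa p b : R) :
  (2 <= n)%N ->
  0 < delta -> delta <= n%:R ->
  0 <= kappa -> kappa < 1 ->
  delta / n%:R < p -> (kappa = 0 \/ p < delta / kappa) ->
  0 < b ->
  exists c : R, 0 < c /\
    forall O : set 'rV[R]_n, open O -> O != setT -> outer_regular O b ->
    forall u : 'rV[R]_n -> R, C1_0 O u ->
      (choquet (delta - kappa * p) O
         (fun x => (`|u x| `^ p / dist_bdry O x `^ (p * (1 - kappa)))%R)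
       <= c%:E * choquet delta O (fun x => (grad_norm u x `^ p)%R))%E.
Proof.
case: n => // n _ delta0 deltan kappa0 kappa1 deltap kp b0.
(* The product form of the upper bound on [p] covers [kappa = 0] as well. *)
have kappap : kappa * p < delta.
  have [->|k0] := eqVneq kappa 0; first by rewrite mul0r.
  case: kp => [k00|]; first by rewrite k00 eqxx in k0.
  by rewrite ltr_pdivlMr 1?mulrC// lt_neqAle eq_sym k0.
have [c [c0 hc]] := hardy_choquet R n delta kappa p b delta0 deltan kappa0 kappa1 deltap kappap b0.
by exists c; split=> // O _ _ regO u uC; exact: hc.
Qed.
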